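(* Let $G=(V,E)$ be a connected undirected graph with $n$ vertices and $m$ edges and let $W\subseteq V$. There is an algorithm that enumerates all minimal Steiner trees of $(G,W)$, each exactly once, with $O(nm)$ delay and $O(nm)$ space.
   Context: A Steiner subgraph of $(G,W)$ is a subgraph of $G$ containing a path between every pair of vertices of $W$; a minimal Steiner tree of $(G,W)$ is a Steiner subgraph of $(G,W)$ none of whose proper subgraphs is a Steiner subgraph. The delay of an enumeration algorithm is the maximum running time between two consecutive outputs, including before the first and after the last output. Space is counted in words of $O(\log n)$ bits. *)

(* Defs.v *)
From mathcomp Require Import all_boot.

Set Implicit Arguments.
Unset Strict Implicit.
Unset Printing Implicit Defensive.

(** * Graphs and minimal Steiner trees *)

(** Finite simple undirected graphs; the vertex set is the whole of [T]. *)
Record graph (T : finType) := Graph {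
  edges : {set {set T}};
  edges_card2 : {in edges, forall e : {set T}, #|e| = 2}
}.

Definition connected (T : finType) (G : graph T) : Prop :=
  forall x y : T, connect (fun u v => [set u; v] \in edges G) x y.

(** A pair (vertex set, edge set); see [is_subgraph]. *)
Definition vesets (T : finType) : finType := ({set T} * {set {set T}})%type.

Section Steiner.
Variables (T : finType) (G : graph T) (W : {set T}).
Implicit Types H K : vesets T.

Definition is_subgraph H : Prop :=
  H.2 \subset edges G /\ {in H.2, forall e : {set T}, e \subset H.1}.

Definition contains_path H (u v : T) : Prop :=
  exists p : seq T,
    [/\ {subset u :: p <= H.1}, path (fun x y => [set x; y] \in H.2) u p,
        uniq (u :: p) & last u p = v].

(** The pairs include [u = v] (trivial path), so a Steiner subgraph contains
    every vertex of [W], also when [W] is a singleton. *)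
Definition steiner_subgraph H : Prop :=
  is_subgraph H /\ {in W &, forall u v, contains_path H u v}.

Definition proper_subgraph K H : Prop :=
  [/\ is_subgraph K, K.1 \subset H.1, K.2 \subset H.2 & K <> H].

Definition minimal_steiner_tree H : Prop :=
  steiner_subgraph H /\ forall K, proper_subgraph K H -> ~ steiner_subgraph K.

End Steiner.

(** * A word RAM with structured control

    A program has finitely many registers (those it mentions) and a random
    access memory.  The semantics is parametrised by the word bound [B] (every
    value is [< B]) and the number [M] of memory words (every address is
    [< M]); a program that exceeds either bound has no execution.  Every node of
    an expression and every command costs one time unit. *)

Inductive binop := Add | Sub | Mul | Div | Eq | Lt.

Definition eval_binop (o : binop) : nat -> nat -> nat :=
  match o with
  | Add => addn
  | Sub => subn
  | Mul => muln
  | Div => divn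
  | Eq => fun a b => nat_of_bool (a == b)
  | Lt => fun a b => nat_of_bool (a < b)
  end.

Inductive expr :=
| Const of nat
| Reg of nat
| Read of expr
| Op of binop & expr & expr.

Inductive cmd :=
| Assign of nat & expr
| Write of expr & expr
| Seq of cmd & cmd
| If of expr & cmd & cmd
| While of expr & cmd
| Emit of expr
| Yield.

Record state := State { regs : nat -> nat; mem : nat -> nat }.

(** An execution trace has one event per time unit.  [Word v] writes the word
    [v] on the write-only output stream and [Output] ends the current
    solution. *)
Inductive event := Tick | Word of nat | Output.

Fixpoint cost (e : expr) : nat :=
  match e with
  | Const _ | Reg _ => 1
  | Read a => (cost a).+1
  | Op _ e1 e2 => (cost e1 + cost e2).+1
  end.

Definition update (f : nat -> nat) (i v : nat) : nat -> nat :=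
  fun j => if j == i then v else f j.

Section Semantics.
Variables (B M : nat).

Definition below (b v : nat) : option nat := if v < b then Some v else None.

Fixpoint eval (s : state) (e : expr) : option nat :=
  match e with
  | Const k => below B k
  | Reg x => Some (regs s x)
  | Read a => omap (mem s) (obind (below M) (eval s a))
  | Op o e1 e2 =>
      obind (fun v1 => obind (fun v2 => below B (eval_binop o v1 v2))
                             (eval s e2)) (eval s e1)
  end.

Definition ticks (e : expr) : seq event := nseq (cost e) Tick.

Inductive exec : cmd -> state -> seq event -> state -> Prop :=
| ExecAssign x e s v :
    eval s e = Some v ->
    exec (Assign x e) s (rcons (ticks e) Tick)
         (State (update (regs s) x v) (mem s))
| ExecWrite e1 e2 s a v :
    eval s e1 = Some a -> a < M -> eval s e2 = Some v ->
    exec (Write e1 e2) s (rcons (ticks e1 ++ ticks e2) Tick)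
         (State (regs s) (update (mem s) a v))
| ExecSeq c1 c2 s1 s2 s3 t1 t2 :
    exec c1 s1 t1 s2 -> exec c2 s2 t2 s3 ->
    exec (Seq c1 c2) s1 (Tick :: t1 ++ t2) s3
| ExecIf e c1 c2 s v t s' :
    eval s e = Some v -> exec (if v != 0 then c1 else c2) s t s' ->
    exec (If e c1 c2) s (rcons (ticks e) Tick ++ t) s'
| ExecWhileFalse e c s :
    eval s e = Some 0 ->
    exec (While e c) s (rcons (ticks e) Tick) s
| ExecWhileTrue e c s1 v t1 s2 t2 s3 :
    eval s1 e = Some v -> v != 0 ->
    exec c s1 t1 s2 -> exec (While e c) s2 t2 s3 ->
    exec (While e c) s1 (rcons (ticks e) Tick ++ t1 ++ t2) s3
| ExecEmit e s v :
    eval s e = Some v ->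
    exec (Emit e) s (rcons (ticks e) (Word v)) s
| ExecYield s :
    exec Yield s [:: Output] s.

(** [p] halts on [input], placed at the beginning of an otherwise zero memory
    (and counted in [M]), with trace [t]. *)
Definition run (p : cmd) (input : seq nat) (t : seq event) : Prop :=
  [/\ size input <= M, all (fun v => v < B) input
    & exists s', exec p (State (fun=> 0) (nth 0 input)) t s'].

End Semantics.

(** Cuts a trace just after each [Output]; the last segment is what follows the
    last [Output]. *)
Definition segments (t : seq event) : seq (seq event) :=
  foldr (fun ev ss => if ev is Output then [:: ev] :: ss
                      else (ev :: head [::] ss) :: behead ss) [:: [::]] t.

Definition delay (t : seq event) : nat := \max_(s <- segments t) size s.

Definition words (t : seq event) : seq nat :=
  pmap (fun ev => if ev is Word v then Some v else None) t.

(** The solutions written in [t] are [outs]; nothing is written after the last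
    one. *)
Definition writes (t : seq event) (outs : seq (seq nat)) : Prop :=
  [seq words s | s <- segments t] = rcons outs [::].

(** * Input and output encodings *)

Section Encoding.
Variable n : nat.

Definition lists (T : finType) (s : seq T) (A : {set T}) : Prop :=
  uniq s /\ s =i A.

(** Each edge appears once, in either orientation. *)
Definition lists_edges (es : seq ('I_n * 'I_n)) (E : {set {set 'I_n}}) : Prop :=
  lists [seq [set e.1; e.2] | e <- es] E.

Definition edge_words (es : seq ('I_n * 'I_n)) : seq nat :=
  flatten [seq [:: val e.1; val e.2] | e <- es].

Definition input_words (es : seq ('I_n * 'I_n)) (ws : seq 'I_n) : seq nat :=
  [:: n; size es; size ws] ++ edge_words es ++ map val ws.

Definition encodes (out : seq nat) (H : vesets 'I_n) : Prop :=
  exists vs es, [/\ lists vs H.1, lists_edges es H.2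
                  & out = size vs :: map val vs ++ edge_words es].

(** The trace outputs exactly the [H] satisfying [P], each exactly once. *)
Definition enumerates (t : seq event) (P : vesets 'I_n -> Prop) : Prop :=
  exists (Hs : seq (vesets 'I_n)) (outs : seq (seq nat)),
    [/\ uniq Hs, forall H, H \in Hs <-> P H, writes t outs,
        size outs = size Hs
      & forall i, i < size Hs -> encodes (nth [::] outs i) (nth (set0, set0) Hs i)].

End Encoding.

(** [c * (log n + 1)]-bit words. *)
Definition word_bound (c n : nat) : nat := 2 ^ (c * (trunc_log 2 n).+1).

(** [O(nm)] is rendered as [c * (n * m + 1)]: a connected graph has [n * m = 0]
    only if it has at most one vertex. *)
Definition nm_bound (c n m : nat) : nat := c * (n * m).+1.

(* Main.v *)
(** Fix a terminal [r].  A minimal Steiner tree [H] containing [r] is oriented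
    towards [r]: every other vertex [x] of [H] has a unique neighbour, its parent,
    from which [H] leads to [r] without passing through [x] (two such neighbours
    would close a cycle).  The algorithm builds [H] one parent at a time.  It
    starts a path at a terminal outside the current tree, extends it arc by arc
    until it hits the tree, and restarts from the next terminal.  An extension from
    [u] to [v] is allowed exactly when [v] can still reach [r] without using the
    vertices of the current path, so that no partial choice is ever a dead end, the
    completed choices are the minimal Steiner trees, and distinct choices give
    distinct trees.

    Every step of this backtracking costs one graph search, hence time [O(m)].
    Each step adds or removes one vertex, the stack has at most [n] vertices, and
    there are no dead ends; hence two consecutive outputs are separated by at most
    [n] removals followed by at most [2 n] steps downwards, which gives the delay
    [O(n m)]. *)

(* [minimal_steiner_tree] speaks of minimality alone, and no theory of trees or cycles is developed.
   All that the search takes from it is that a vertex has at most one parent ([parent_inj]).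
   Completeness follows, because the parent arc in a tree that agrees with the choices made so far
   is never rejected; so does the disjointness of different branches.

   Whether an extension is legal is a question of reachability in an undirected graph, so a single
   search from [r] answers it for all arcs leaving the tip at once. This keeps a step linear however
   many arcs there are to try. The marks of a search are not saved: a frame stores a vertex, the
   start of its path and an arc pointer, and a resumed frame repeats its search. The memory is
   therefore linear in [n + m].

   Correctness and the number of steps between outputs are proved for an abstract machine on stacks,
   which the program then simulates one loop turn per step. Connectedness enters twice: a new
   terminal can always reach the root, and [n <= 2 * m] for [n > 1] turns linear bounds into [O(nm)]
   ones. An empty [W] offers no root and is treated apart. *)
From mathcomp Require Import all_boot zify.
Require Import Defs.

Set Implicit Arguments.
Unset Strict Implicit.
Unset Printing Implicit Defensive.

(** * Traces and a program logic for the word RAM *)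

Definition quiet (t : seq event) : bool :=
  all (fun ev => if ev is Output then false else true) t.

Lemma quiet_cat t1 t2 : quiet (t1 ++ t2) = quiet t1 && quiet t2.
Proof. exact: all_cat. Qed.

Lemma words_cat t1 t2 : words (t1 ++ t2) = words t1 ++ words t2.
Proof. exact: pmap_cat. Qed.

Lemma words_ticks e : words (ticks e) = [::].
Proof. by rewrite /ticks; elim: (cost e). Qed.

Lemma quiet_ticks e : quiet (ticks e).
Proof. by rewrite /ticks /quiet all_nseq orbT. Qed.

Lemma size_ticks e : size (ticks e) = cost e.
Proof. by rewrite size_nseq. Qed.

Lemma segments_neq0 t : segments t = head [::] (segments t) :: behead (segments t).
Proof. by case: t => [|[|v|] t]. Qed.

Lemma segments_quiet t0 t : quiet t0 ->
  segments (t0 ++ t) = (t0 ++ head [::] (segments t)) :: behead (segments t).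
Proof.
elim: t0 => [|[|v|] t0 IH] //= q; first by rewrite -segments_neq0.
- by rewrite -/(segments _) IH.
- by rewrite -/(segments _) IH.
Qed.

Lemma segments_output t0 t : quiet t0 ->
  segments (t0 ++ Output :: t) = rcons t0 Output :: segments t.
Proof. by move=> q; rewrite segments_quiet //= cats1. Qed.

(** [a] bounds the first segment of [t] and [D] the other ones. *)
Definition traced (t : seq event) (outs : seq (seq nat)) (a D : nat) : Prop :=
  [/\ writes t outs, size (head [::] (segments t)) <= a
    & all (fun s => size s <= D) (behead (segments t))].

Lemma traced_quiet t0 t outs a D b : quiet t0 -> words t0 = [::] ->
  traced t outs a D -> size t0 + a <= b -> traced (t0 ++ t) outs b D.
Proof.
move=> q w0 [wr ha hD] hb; split; rewrite ?segments_quiet //=.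
  move: wr; rewrite /writes segments_quiet //= (segments_neq0 t) /=.
  by rewrite words_cat w0.
by rewrite size_cat; lia.
Qed.

Lemma traced_output t0 t outs a D b : quiet t0 ->
  traced t outs a D -> a <= D -> size t0 < b ->
  traced (t0 ++ Output :: t) (words t0 :: outs) b D.
Proof.
move=> q [wr ha hD] haD hb; split; rewrite ?segments_output //=.
- rewrite /writes segments_output //= wr.
  by rewrite -cats1 words_cat /= cats0.
- by rewrite size_rcons.
- by rewrite segments_neq0 /= hD andbT; lia.
Qed.

Lemma traced_nil t a D : quiet t -> words t = [::] -> size t <= a ->
  traced t [::] a D.
Proof.
by move=> q w0 h; rewrite -[t]cats0; split; rewrite ?/writes segments_quiet //=
  ?cats0 ?w0.
Qed.

Lemma traced_delay t outs a D b : traced t outs a D -> a <= b -> D <= b ->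
  delay t <= b.
Proof.
move=> [_ ha hD] hab hDb; rewrite /delay segments_neq0 big_cons geq_max.
rewrite (leq_trans ha hab) /=; elim: (behead _) hD => [|s ss IH] /=.
  by rewrite big_nil.
by case/andP=> hs /IH; rewrite big_cons geq_max (leq_trans hs hDb).
Qed.

(** A copy of [update] for memories, so that updates of registers can be unfolded
    alone. *)
Definition mupdate : (nat -> nat) -> nat -> nat -> nat -> nat := update.
Arguments mupdate : simpl never.

Section Logic.
Variables B M : nat.

(** Total correctness with a time bound. Traces are required to be quiet so that the costs of
    successive commands add up inside one segment; a [Yield] has to be handled on executions
    directly. *)
Definition hoare c s k w (Q : state -> Prop) : Prop :=
  exists t s', [/\ exec B M c s t s', size t <= k, quiet t, words t = w & Q s'].

Lemma hoare_weak c s k k' w (Q Q' : state -> Prop) :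
  hoare c s k w Q -> k <= k' -> (forall s', Q s' -> Q' s') -> hoare c s k' w Q'.
Proof.
move=> [t [s' [h1 h2 h3 h4 h5]]] hk hQ; exists t, s'; split=> //; first by lia.
exact: hQ.
Qed.

Lemma hoare_seq c1 c2 s k1 k2 k w1 w2 w (Q : state -> Prop) :
  hoare c1 s k1 w1 (fun s' => hoare c2 s' k2 w2 Q) -> k1 + k2 < k ->
  w = w1 ++ w2 -> hoare (Seq c1 c2) s k w Q.
Proof.
move=> [t1 [s1 [h1 h2 h3 h4 [t2 [s2 [g1 g2 g3 g4 g5]]]]]] hk ->.
exists (Tick :: t1 ++ t2), s2; split=> //.
- exact: ExecSeq h1 g1.
- by rewrite /= size_cat; lia.
- by rewrite /= quiet_cat h3.
- by rewrite /= -/(words _) words_cat h4 g4.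
Qed.

(** A total counterpart of [eval]: the word and address bounds are split off into [safe], which
    leaves values free of options. *)
Fixpoint ev (s : state) (e : expr) : nat :=
  match e with
  | Const k => k
  | Reg x => regs s x
  | Read a => mem s (ev s a)
  | Op o e1 e2 => eval_binop o (ev s e1) (ev s e2)
  end.

Fixpoint safe (s : state) (e : expr) : Prop :=
  match e with
  | Const k => k < B
  | Reg _ => True
  | Read a => safe s a /\ ev s a < M
  | Op o e1 e2 => [/\ safe s e1, safe s e2 & ev s (Op o e1 e2) < B]
  end.

Lemma eval_safe s e : safe s e -> eval B M s e = Some (ev s e).
Proof.
elim: e => [k|x|a IH|o e1 IH1 e2 IH2] //=.
- by rewrite /below => ->.
- by case=> /IH -> /=; rewrite /below => ->.
- by case=> /IH1 -> /IH2 -> /=; rewrite /below => ->.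
Qed.

Lemma hoare_if e c1 c2 s k k' w (Q : state -> Prop) :
  safe s e -> (ev s e != 0 -> hoare c1 s k w Q) ->
  (ev s e = 0 -> hoare c2 s k w Q) -> cost e + k < k' ->
  hoare (If e c1 c2) s k' w Q.
Proof.
move=> se h1 h2 hk.
have [t [s' [g1 g2 g3 g4 g5]]] : hoare (if ev s e != 0 then c1 else c2) s k w Q.
  by case: eqP => [/h2|/eqP/h1].
exists (rcons (ticks e) Tick ++ t), s'; split=> //.
- by apply: ExecIf (eval_safe se) g1.
- by rewrite size_cat size_rcons size_ticks; lia.
- by rewrite quiet_cat g3 -cats1 quiet_cat quiet_ticks.
- by rewrite words_cat -cats1 words_cat words_ticks.
Qed.

Lemma hoare_emit e s k v (Q : state -> Prop) :
  safe s e -> v = ev s e -> cost e < k -> Q s -> hoare (Emit e) s k [:: v] Q.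
Proof.
move=> se -> hk q; exists (rcons (ticks e) (Word (ev s e))), s; split=> //.
- exact: ExecEmit (eval_safe se).
- by rewrite size_rcons size_ticks.
- by rewrite -cats1 quiet_cat quiet_ticks.
- by rewrite -cats1 words_cat words_ticks.
Qed.

(** Only for loop-free silent commands: the other ones get [False], and cost 0. *)
Fixpoint wp (c : cmd) (s : state) (Q : state -> Prop) : Prop :=
  match c with
  | Assign x e => safe s e /\ Q (State (update (regs s) x (ev s e)) (mem s))
  | Write e1 e2 => [/\ safe s e1, ev s e1 < M, safe s e2
                     & Q (State (regs s) (mupdate (mem s) (ev s e1) (ev s e2)))]
  | Seq c1 c2 => wp c1 s (fun s' => wp c2 s' Q)
  | If e c1 c2 => [/\ safe s e, ev s e != 0 -> wp c1 s Q
                    & ev s e = 0 -> wp c2 s Q]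
  | _ => False
  end.

Fixpoint wcost (c : cmd) : nat :=
  match c with
  | Assign _ e => (cost e).+1
  | Write e1 e2 => (cost e1 + cost e2).+1
  | Seq c1 c2 => (wcost c1 + wcost c2).+1
  | If e c1 c2 => (cost e + (wcost c1 + wcost c2)).+1
  | _ => 0
  end.

Lemma wp_hoare c s k (Q : state -> Prop) :
  wp c s Q -> wcost c <= k -> hoare c s k [::] Q.
Proof.
elim: c s k Q => //= [x e|e1 e2|c1 IH1 c2 IH2|e c1 IH1 c2 IH2] s k Q.
- move=> [se q] hk.
  exists (rcons (ticks e) Tick), (State (update (regs s) x (ev s e)) (mem s)).
  split=> //.
  + exact: ExecAssign (eval_safe se).
  + by rewrite size_rcons size_ticks.
  + by rewrite -cats1 quiet_cat quiet_ticks.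
  + by rewrite -cats1 words_cat words_ticks.
- move=> [se1 lt1 se2 q] hk.
  exists (rcons (ticks e1 ++ ticks e2) Tick),
         (State (regs s) (update (mem s) (ev s e1) (ev s e2))).
  split=> //.
  + exact: ExecWrite (eval_safe se1) lt1 (eval_safe se2).
  + by rewrite size_rcons size_cat !size_ticks.
  + by rewrite -cats1 !quiet_cat !quiet_ticks.
  + by rewrite -cats1 !words_cat !words_ticks.
- move=> h hk.
  apply: (@hoare_seq _ _ _ (wcost c1) (wcost c2) _ [::] [::]) => //.
  apply: hoare_weak (IH1 _ _ _ h (leqnn _)) (leqnn _) _ => s' h'.
  exact: IH2.
- move=> [se h1 h2] hk.
  apply: (@hoare_if _ _ _ _ (wcost c1 + wcost c2)) => //.
  + by move=> /h1 h; apply: IH1 => //; lia.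
  + by move=> /h2 h; apply: IH2 => //; lia.
Qed.

(** In [I i w s], [i] bounds the number of remaining iterations and [w] is the
    word stream that they emit. *)
Lemma hoare_while_emit e c (I : nat -> seq nat -> state -> Prop) k
    (Q : state -> Prop) i w s k' :
  (forall i w s, I i w s -> safe s e) ->
  (forall i w s, I i w s -> ev s e = 0 -> w = [::] /\ Q s) ->
  (forall i w s, I i w s -> ev s e != 0 ->
     0 < i /\ exists w1 w2, w = w1 ++ w2 /\ hoare c s k w1 (I i.-1 w2)) ->
  I i w s -> (cost e).+1 + i * (k + (cost e).+1) <= k' ->
  hoare (While e c) s k' w Q.
Proof.
move=> hs h0 h1; elim: i w s k' => [|i IH] w s k' Ii hk.
all: have se := hs _ _ _ Ii.
all: case: (eqVneq (ev s e) 0) => [e0|e1].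
1,3: have [-> Qs] := h0 _ _ _ Ii e0.
1,2: exists (rcons (ticks e) Tick), s; split=> //.
1,5: by apply: ExecWhileFalse; rewrite -e0; apply: eval_safe.
1,4: by rewrite size_rcons size_ticks; lia.
1,3: by rewrite -cats1 quiet_cat quiet_ticks.
1,2: by rewrite -cats1 words_cat words_ticks.
- by have [] := h1 _ _ _ Ii e1.
- have [_ [w1 [w2 [-> [t1 [s1 [g1 g2 g3 g4 g5]]]]]]] := h1 _ _ _ Ii e1.
  have := IH w2 s1 (k' - (k + (cost e).+1)) g5.
  case=> [|t2 [s2 [f1 f2 f3 f4 f5]]]; first by lia.
  exists (rcons (ticks e) Tick ++ t1 ++ t2), s2; split=> //.
  + exact: ExecWhileTrue (eval_safe se) e1 g1 f1.
  + by rewrite !size_cat size_rcons size_ticks; lia.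
  + by rewrite !quiet_cat -cats1 quiet_cat quiet_ticks g3 f3.
  + by rewrite !words_cat -cats1 words_cat words_ticks g4 f4.
Qed.

Lemma hoare_while e c (I : nat -> state -> Prop) k (Q : state -> Prop) i s k' :
  (forall i s, I i s -> safe s e) ->
  (forall i s, I i s -> ev s e = 0 -> Q s) ->
  (forall i s, I i s -> ev s e != 0 ->
     0 < i /\ hoare c s k [::] (I i.-1)) ->
  I i s -> (cost e).+1 + i * (k + (cost e).+1) <= k' ->
  hoare (While e c) s k' [::] Q.
Proof.
move=> hs h0 h1 Ii hk.
apply: (@hoare_while_emit _ _ (fun i w s => w = [::] /\ I i s) k _ i) => //.
- by move=> j w s' [_ /hs].
- by move=> j w s' [-> /h0 h] /h.
- move=> j w s' [-> /h1 h] /h [j0 hb]; split=> //; exists [::], [::]; split=> //.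
  by apply: hoare_weak hb (leqnn _) _.
Qed.

End Logic.

(** * Parents in minimal Steiner trees *)

Definition rel_minus (T : finType) (e : rel T) (x : T) : rel T :=
  fun a b => [&& e a b, a != x & b != x].

(** A path without repetitions never comes back to its first vertex. This is the source of parents
    in a tree and of legal extensions in the search. *)
Lemma connect_step_avoid (T : finType) (e : rel T) (x z : T) :
  connect e x z -> x != z ->
  exists2 y, e x y & connect (rel_minus e x) y z.
Proof.
move=> /connectP [p ep ->] {z}; case/shortenP: ep => -[|y q] /=.
  by rewrite eqxx.
case/andP=> exy eq /andP[xq _] _ _; exists y => //.
apply/connectP; exists q => //; elim: q y {exy} eq xq => //= z q IH y.
case/andP=> eyz eq; rewrite !inE !negb_or => /and3P[xy xz xq].
rewrite {1}/rel_minus eyz eq_sym xy eq_sym xz /=; apply: IH => //.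
by rewrite inE negb_or xz.
Qed.

Lemma connect_mono (T : finType) (e e' : rel T) (x y : T) :
  subrel e e' -> connect e x y -> connect e' x y.
Proof. by move=> h; apply: connect_sub => a b /h /connect1. Qed.

Lemma connect_cross (T : finType) (e : rel T) (D : pred T) (x y : T) :
  connect e x y -> D x -> ~~ D y -> exists a b, [/\ e a b, D a & ~~ D b].
Proof.
move=> /connectP [p ep ->]; elim: p x ep => [|z p IH] x /=.
  by move=> _ ->.
case/andP=> exz ep Dx; case Dz: (D z); first exact: IH.
by move=> _; exists x, z; rewrite exz Dx Dz.
Qed.

Section Steiner.
Variables (T : finType) (G : graph T) (W : {set T}) (r : T).
Hypothesis rW : r \in W.
Implicit Types (H K : vesets T) (x y z u v w : T).

Definition adj : rel T := fun x y => [set x; y] \in edges G.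
Definition adjin H : rel T := fun x y => [set x; y] \in H.2.

Lemma adj_sym : symmetric adj.
Proof. by move=> x y; rewrite /adj setUC. Qed.

Lemma adjin_sym H : symmetric (adjin H).
Proof. by move=> x y; rewrite /adjin setUC. Qed.

Lemma adj_neq x y : adj x y -> x != y.
Proof.
by move/edges_card2; rewrite cards2; case: (x != y).
Qed.

Lemma contains_path_connect H u v :
  is_subgraph G H -> contains_path H u v <-> (u \in H.1) && connect (adjin H) u v.
Proof.
move=> [_ Hs]; split=> [[p [sub ep _ <-]]|/andP[uH /connectP [p ep ->]]].
  rewrite sub ?inE ?eqxx //=; apply/connectP; by exists p.
case/shortenP: ep => q eq uq _; exists q; split=> //.
elim: q u uH eq {uq} => [|z q IH] u uH /=; first by move=> _ x; rewrite inE => /eqP->.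
case/andP=> ez eq x; rewrite inE => /orP [/eqP->//|].
apply: IH eq x; move/Hs: ez => /subsetP; apply; exact: set22.
Qed.

Lemma steiner_subgraphP H :
  steiner_subgraph G W H <->
  is_subgraph G H /\ {in W, forall w, (w \in H.1) && connect (adjin H) w r}.
Proof.
split=> -[Hs h]; split=> //.
  by move=> w wW; apply/contains_path_connect => //; apply: h.
move=> u v /h/andP[uH ur] /h/andP[vH vr]; apply/contains_path_connect => //.
rewrite uH /=; apply: connect_trans ur _.
by rewrite (sym_connect_sym (adjin_sym H)).
Qed.

(** [y] is the neighbour of [x] through which [H] leads from [x] to the root. *)
Definition parent H x y : Prop :=
  adjin H x y /\ connect (rel_minus (adjin H) x) y r.

Lemma parent_exists H x :
  x != r -> connect (adjin H) x r -> exists y, parent H x y.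
Proof.
by move=> xr /connect_step_avoid /(_ xr) [y exy yr]; exists y.
Qed.

Lemma minimal_connect H w :
  minimal_steiner_tree G W H -> w \in W -> connect (adjin H) w r.
Proof. by move=> [/steiner_subgraphP [_ h] _] /h /andP[]. Qed.

Lemma minimal_adj H x y : minimal_steiner_tree G W H -> adjin H x y -> adj x y.
Proof. by move=> [[[/subsetP s _] _] _] /s. Qed.

Lemma parent_connect H x y : parent H x y -> connect (adjin H) y r.
Proof. by move=> [_]; apply: connect_mono => a b /and3P[]. Qed.

(* If both [y] and [y'] lead to the root without using [x], the edge from [x] to
   [y'] closes a cycle and can be removed. *)
Lemma parent_inj H x y y' :
  minimal_steiner_tree G W H -> parent H x y -> parent H x y' -> y = y'.
Proof.
move=> Hmin [xy yr] [xy' yr']; apply/eqP/negPn/negP => neq.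
have [nx nx'] := (adj_neq (minimal_adj Hmin xy), adj_neq (minimal_adj Hmin xy')).
have [/steiner_subgraphP [[sH cH] hW] Hmin'] := Hmin.
pose K : vesets T := (H.1, H.2 :\ [set x; y']).
have adjK a b : adjin K a b = ([set a; b] != [set x; y']) && adjin H a b.
  by rewrite /adjin in_setD1.
have Ks : is_subgraph G K.
  split=> /=; first by apply: subset_trans sH; apply: subD1set.
  by move=> e /setD1P[_ /cH].
have away z : connect (rel_minus (adjin H) x) z r -> connect (adjin K) z r.
  apply: connect_mono => a b /and3P[ab ax bx]; rewrite adjK ab andbT.
  apply/eqP => /setP/(_ x); rewrite !inE eqxx /= => /orP.
  by rewrite !(eq_sym x) (negPf ax) (negPf bx) => -[].
have symK := sym_connect_sym (adjin_sym K).
(* The detour that replaces the deleted edge: from [x] to [y], on to the root, and back to [y'].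
   Neither of the two routes to the root meets [x], so neither uses that edge. *)
have xyK : connect (adjin K) x y'.
  apply: (@connect_trans _ _ y); last first.
    by apply: connect_trans (away _ yr) _; rewrite symK away.
  apply: connect1; rewrite adjK xy andbT.
  apply/eqP => /setP/(_ y); rewrite !inE eqxx orbT.
  by rewrite (negPf neq) eq_sym (negPf nx).
apply: (Hmin' K); last first.
  apply/steiner_subgraphP; split=> // w /hW /andP[-> /=].
  apply: connect_sub => a b ab.
  case: (eqVneq [set a; b] [set x; y']) => [eqe|ne]; last first.
    by apply: connect1; rewrite adjK ne.
  have [ax bx] : a \in [set x; y'] /\ b \in [set x; y'].
    by rewrite -eqe !inE !eqxx orbT.
  have nab := adj_neq (minimal_adj Hmin ab).
  move: ax bx nab; rewrite !inE => /orP[]/eqP-> /orP[]/eqP->; rewrite ?eqxx //.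
  by rewrite symK.
split=> //=; first exact: subD1set.
move=> /(congr1 snd) /= /setP/(_ [set x; y']).
by rewrite in_setD1 eqxx /=; move: xy'; rewrite /adjin => ->.
Qed.

End Steiner.

(** * The backtracking search *)

(** The result is one past the hit: it is the pointer from which the scan will resume. Being
    positive, it also distinguishes a frame that has chosen an arc from a fresh one, whose pointer
    is 0. *)
Fixpoint scan (P : pred nat) (k p : nat) : option nat :=
  if k is k'.+1 then if P p then Some p.+1 else scan P k' p.+1 else None.

Lemma scan_some P k p q : scan P k p = Some q ->
  [/\ P q.-1, p < q <= p + k & forall i, p <= i < q.-1 -> ~~ P i].
Proof.
elim: k p => [|k IH] p //=; case: ifP => [Pp [<-]|nP /IH [Pq hq hi]].
  by split=> //; lia.
split=> //; first by lia.
move=> i hip; case: (eqVneq i p) => [->|ne]; first by rewrite nP.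
by apply: hi; lia.
Qed.

Lemma scan_none P k p : scan P k p = None -> forall i, p <= i < p + k -> ~~ P i.
Proof.
elim: k p => [|k IH] p /=; first by move=> _ i; lia.
case: ifP => // nP /IH hi i hip; case: (eqVneq i p) => [->|ne]; first by rewrite nP.
by apply: hi; lia.
Qed.

Section Position.
Variables (T : finType) (r : T).
Implicit Types (x : T) (vs : seq T).

(** [position vs x] is the index of [x], counted from 1, in the stack [vs] whose
    top is its head and below which the root sits; it is 0 outside. *)
Fixpoint position vs x : nat :=
  if vs is v :: vs' then if x == v then (size vs).+1 else position vs' x
  else x == r.

Lemma position_gt0 vs x : (0 < position vs x) = (x \in r :: vs).
Proof.
elim: vs => [|v vs IH] /=; first by rewrite inE; case: eqP.
by rewrite !inE; case: (x == v) => //=; rewrite ?orbT // IH inE.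
Qed.

Lemma position_le vs x : position vs x <= (size vs).+1.
Proof.
elim: vs => [|v vs IH] /=; first by case: eqP.
by case: eqP => // _; lia.
Qed.

Lemma position_root vs : r \notin vs -> position vs r = 1.
Proof.
elim: vs => [|v vs IH] /=; first by rewrite eqxx.
by rewrite inE negb_or => /andP[/negPf-> /IH].
Qed.

End Position.

Section Machine.
Variables (T : finType) (G : graph T) (W : {set T}) (r : T).
Variables (arcs : seq (T * T)) (ws : seq T).
Hypotheses (rW : r \in W) (Gconn : connected G).
Hypotheses (arcsP : forall x y, ((x, y) \in arcs) = adj G x y).
Hypotheses (arcs_uniq : uniq arcs) (wsP : ws =i W).
Implicit Types (H : vesets T) (x y z u v w : T) (vs : seq T).

Definition avoid (p : pred T) : rel T := fun x y => [&& adj G x y, ~~ p x & ~~ p y].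
Definition blocked s vs : pred T := fun x => s < position r vs x.
(** The vertices of the unfinished path are those above position [s]. The search starts at the root,
    so that one set of marks decides every candidate [v]. *)
Definition valid s vs v := connect (avoid (blocked s vs)) r v.

Lemma avoid_sym p : symmetric (avoid p).
Proof. by move=> x y; rewrite /avoid adj_sym [X in _ && X]andbC. Qed.

(** A frame [(u, s, p)] consists of a vertex [u], the position [s] below the first
    vertex of the path through [u], and the next arc [p] to be tried at [u].  Below
    the top of the stack, [p.-1] is the arc chosen at [u]. *)
Definition frame := (T * nat * nat)%type.
Implicit Types (fs : seq frame) (f : frame).

Definition verts fs : seq T := [seq f.1.1 | f <- fs].
(** The source is read from the frame rather than from the arc, so that the sources of the chosen
    arcs are [verts fs] by computation. *)
Definition chosen f : T * T := (f.1.1, (nth (r, r) arcs f.2.-1).2).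
Definition link fs : rel T := fun x y => (x, y) \in map chosen fs.

(** The frame of the tip [u] is not part of [fs]. [gr_path] and [gr_tree] make a comparison with [s]
    separate the unfinished path from the tree; [gr_term] will give minimality, and [gr_reach]
    excludes dead ends. *)
Record growing u s fs : Prop := Growing {
  gr_uniq : uniq (r :: u :: verts fs);
  gr_link : forall x y, link fs x y ->
              [/\ adj G x y, x \in verts fs & y \in r :: u :: verts fs];
  gr_term : {in u :: verts fs, forall x, exists2 w, w \in W & connect (link fs) w x};
  gr_path : forall x, s < position r (u :: verts fs) x -> connect (link fs) x u;
  gr_tree : forall x, 0 < position r (u :: verts fs) x <= s -> connect (link fs) x r;
  gr_reach : connect (avoid (fun x => blocked s (u :: verts fs) x && (x != u))) r u;
  gr_start : 0 < s <= (size fs).+1;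
  gr_ptr : all (fun f => 0 < f.2 <= size arcs) fs
}.

Record arrived fs : Prop := Arrived {
  ar_uniq : uniq (r :: verts fs);
  ar_link : forall x y, link fs x y ->
              [/\ adj G x y, x \in verts fs & y \in r :: verts fs];
  ar_term : {in verts fs, forall x, exists2 w, w \in W & connect (link fs) w x};
  ar_tree : {in r :: verts fs, forall x, connect (link fs) x r};
  ar_ptr : all (fun f => 0 < f.2 <= size arcs) fs
}.

Lemma link_cons f fs : subrel (link fs) (link (f :: fs)).
Proof. by move=> x y; rewrite /link inE => ->; rewrite orbT. Qed.

Lemma verts_link fs x : x \in verts fs -> exists y, link fs x y.
Proof.
by case/mapP=> f ff ->; exists (chosen f).2; rewrite /link; apply: (map_f chosen).
Qed.

Lemma link_inj fs x y y' : uniq (verts fs) -> link fs x y -> link fs x y' -> y = y'.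
Proof.
rewrite /link; elim: fs => [|f fs IH] //= /andP[fu ufs]; rewrite !inE /chosen.
have out z : (x, z) \in map chosen fs -> x \in verts fs.
  by case/mapP => g gfs [-> _]; apply/mapP; exists g.
case/orP=> [/eqP[xf ->]|xy] /orP[/eqP[xf' ->]|xy'] //; last exact: IH.
- by move: fu; rewrite -xf (out _ xy').
- by move: fu; rewrite -xf' (out _ xy).
Qed.

Lemma valid_unblocked s vs v : r \notin vs -> 0 < s -> valid s vs v ->
  ~~ blocked s vs v.
Proof.
move=> rvs s0; rewrite /valid (sym_connect_sym (avoid_sym _)) => /connectP[[|z p]] /=.
  by move=> _ <-; rewrite /blocked position_root // -leqNgt.
by move=> /andP[/and3P[]].
Qed.

(** * Preservation of the invariants by one extension *)

Section Child.
Variables (u : T) (s q : nat) (fs : seq frame).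
Hypotheses (gr : growing u s fs) (hq : 0 < q <= size arcs).
Let a := nth (r, r) arcs q.-1.
Hypotheses (au : a.1 = u) (av : valid s (u :: verts fs) a.2).
Let fs' := (u, s, q) :: fs.

Let link_u : link fs' u a.2.
Proof. by rewrite /link inE /chosen eqxx. Qed.

Let link_fs' x y : link fs' x y -> (x = u /\ y = a.2) \/ link fs x y.
Proof. by rewrite /link inE => /orP[/eqP[-> ->]|]; [left|right]. Qed.

Let up x y : connect (link fs) x y -> connect (link fs') x y.
Proof. by apply: connect_mono; apply: link_cons. Qed.

Let adj_u : adj G u a.2.
Proof.
by rewrite -arcsP -au -surjective_pairing mem_nth //; case/andP: hq; case: (q).
Qed.

Let ptr_fs' : all (fun f => 0 < f.2 <= size arcs) fs'.
Proof. by rewrite /= hq (gr_ptr gr). Qed.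

Let unblk : ~~ blocked s (u :: verts fs) a.2.
Proof.
apply: valid_unblocked => //; last by case/andP: (gr_start gr).
by case/andP: (gr_uniq gr).
Qed.

Lemma growing_arrived : position r (u :: verts fs) a.2 != 0 -> arrived fs'.
Proof.
move=> pv; split; rewrite /fs' ?[verts _]/=.
- exact: gr_uniq gr.
- move=> x y /link_fs' [[-> ->]|/(gr_link gr)[h1 h2 h3]].
    by split=> //; [rewrite inE eqxx | rewrite -position_gt0 lt0n].
  by split=> //; rewrite inE h2 orbT.
- move=> x /(gr_term gr)[w wW wx]; exists w => //; exact: up.
- have vr : connect (link fs') a.2 r.
    apply/up/(gr_tree gr); rewrite lt0n pv /=; move: unblk.
    by rewrite /blocked -leqNgt.
  move=> x; rewrite -position_gt0 => px.
  case: (leqP (position r (u :: verts fs) x) s) => [le|/(gr_path gr)/up xu].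
    by apply/up/(gr_tree gr); rewrite px.
  by apply: connect_trans xu (connect_trans (connect1 link_u) vr).
- exact: ptr_fs'.
Qed.

(** The validity test passed at [u] is exactly [gr_reach] for the new tip: apart from [a.2] itself,
    the blocked vertices have not changed. *)
Lemma growing_growing : position r (u :: verts fs) a.2 = 0 -> growing a.2 s fs'.
Proof.
move=> pv; have nv : a.2 \notin r :: u :: verts fs by rewrite -position_gt0 pv.
have pos_v x : x != a.2 ->
    position r (a.2 :: verts fs') x = position r (u :: verts fs) x.
  by move=> /= /negPf->.
split; rewrite ?[verts fs']/=.
- move: nv (gr_uniq gr); rewrite /= !inE !negb_or => /and3P[v1 v2 v3] /and3P[h1 h2 h3].
  by rewrite h2 h3 v2 v3 andbT (eq_sym r) v1 h1.
- move=> x y /link_fs' [[-> ->]|/(gr_link gr)[h1 h2 h3]].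
    by split; rewrite ?inE ?eqxx ?orbT.
  split=> //; rewrite ?inE ?h2 ?orbT //.
  by move: h3; rewrite !inE => /or3P[]->; rewrite ?orbT.
- move=> x; rewrite inE => /orP[/eqP->|].
    have [|w wW wu] := gr_term gr (x := u); first by rewrite inE eqxx.
    exists w => //; exact: connect_trans (up wu) (connect1 link_u).
  move=> /(gr_term gr)[w wW wx]; exists w => //; exact: up.
- move=> x; case: (eqVneq x a.2) => [->|ne]; first by rewrite connect0.
  rewrite [position _ _ _]pos_v // => /(gr_path gr)/up xu.
  exact: connect_trans xu (connect1 link_u).
- move=> x; case: (eqVneq x a.2) => [->|ne].
    rewrite /= eqxx; move: (gr_start gr) => /=; rewrite size_map; lia.
  by rewrite [position _ _ _]pos_v // => /(gr_tree gr)/up.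
- apply: connect_mono av => x y /and3P[xy bx by_]; rewrite /avoid xy /=.
  rewrite /blocked; apply/andP; split; rewrite negb_and.
    by case: (eqVneq x a.2) => [_|ne]; rewrite ?orbT // [position _ _ _]pos_v // bx.
  by case: (eqVneq y a.2) => [_|ne]; rewrite ?orbT // [position _ _ _]pos_v // by_.
- by move: (gr_start gr) => /=; lia.
- exact: ptr_fs'.
Qed.

End Child.

(** The start [(size fs).+1] is the highest position in the tree, so only [w] lies above it. Nothing
    else is blocked, and [gr_reach] is the connectedness of [G]. *)
Lemma arrived_growing fs w : arrived fs -> w \in W -> position r (verts fs) w = 0 ->
  growing w (size fs).+1 fs.
Proof.
move=> ar wW pw; have nw : w \notin r :: verts fs by rewrite -position_gt0 pw.
have sv : size (verts fs) = size fs by rewrite size_map.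
have blk x : (size fs).+1 < position r (w :: verts fs) x -> x = w.
  by move=> /=; case: eqP => // _; have := position_le r (verts fs) x; lia.
split.
- move: nw (ar_uniq ar); rewrite /= !inE !negb_or => /andP[v1 v2] /andP[h1 h2].
  by rewrite v2 h2 (eq_sym r) v1 h1.
- move=> x y /(ar_link ar)[h1 h2 h3]; split=> //.
  by move: h3; rewrite !inE => /orP[]->; rewrite ?orbT.
- move=> x; rewrite inE => /orP[/eqP->|/(ar_term ar)//]; by exists w.
- by move=> x /blk->; apply: connect0.
- move=> x /=; case: eqP => [_|_]; first by lia.
  by case/andP=> px _; apply: ar_tree ar _ _; rewrite -position_gt0.
- apply: connect_mono (Gconn r w) => x y xy; rewrite /avoid /adj xy /=.
  by rewrite /blocked; apply/andP; split; apply/andP=> -[/blk->]; rewrite eqxx.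
- by lia.
- exact: ar_ptr ar.
Qed.

Definition okarc u s fs : pred nat := fun i =>
  let a := nth (r, r) arcs i in (a.1 == u) && valid s (u :: verts fs) a.2.

(** No dead ends: the first arc of a simple path from [u] to the root given by [gr_reach] is legal,
    since the rest of the path avoids [u], the only vertex blocked by [valid] but not by
    [gr_reach]. *)
Lemma growing_okarc u s fs : growing u s fs ->
  exists2 i, i < size arcs & okarc u s fs i.
Proof.
move=> gr; have := gr_reach gr; rewrite (sym_connect_sym (avoid_sym _)) => ur.
have nur : u != r.
  by move: (gr_uniq gr); rewrite /= inE negb_or eq_sym => /andP[/andP[]].
have [v /and3P[uv _ _] vr] := connect_step_avoid ur nur.
have uv_in : (u, v) \in arcs by rewrite arcsP.
exists (index (u, v) arcs); first by rewrite index_mem.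
rewrite /okarc nth_index // eqxx /= /valid (sym_connect_sym (avoid_sym _)).
apply: connect_mono vr => x y /and3P[/and3P[xy bx by_] xu yu].
rewrite /avoid xy /=; move: bx by_; by rewrite xu yu !andbT => -> ->.
Qed.

(** * Minimal Steiner trees that agree with the choices on the stack *)

Definition compatible H fs : Prop := forall x y, link fs x y -> parent r H x y.

Lemma compatible_cons H f fs : compatible H (f :: fs) <->
  parent r H (chosen f).1 (chosen f).2 /\ compatible H fs.
Proof.
split=> [h|[h1 h2] x y].
  split; first by apply: h; rewrite /link inE -surjective_pairing eqxx.
  by move=> x y /(@link_cons f) /h.
by rewrite /link inE => /orP[/eqP xy|/h2//]; move: h1; rewrite -xy.
Qed.

(** A link is a parent step of [H], and parents are unique. A route from [x] to the root that avoids
    [u] would thus begin with the link of [x], and following the links it would end up at [u]. *)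
Lemma descendant_cut H u s fs x : minimal_steiner_tree G W H -> growing u s fs ->
  compatible H fs -> connect (link fs) x u ->
  ~~ connect (rel_minus (adjin H) u) x r.
Proof.
move=> Hmin gr Hc /connectP[p]; elim: p x => [|z p IH] x /=.
  move=> _ <-; apply/negP => /connectP[[|z p]] /=.
    by move=> _ ru; move: (gr_uniq gr); rewrite ru /= inE eqxx.
  by rewrite /rel_minus eqxx andbF.
case/andP=> xz pz lz; apply/negP => xr.
have [_ xv _] := gr_link gr xz.
have nxr : x != r.
  apply: contraTneq xv => ->; move: (gr_uniq gr).
  by rewrite /= inE negb_or => /andP[/andP[]].
have [y /and3P[xy _ _] yr] := connect_step_avoid xr nxr.
have yz : y = z.
  apply: parent_inj Hmin _ (Hc _ _ xz) => //; split=> //.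
  by apply: connect_mono yr => a b /and3P[/and3P[h1 _ _] h2 h3]; apply/and3P.
move/negP: (IH z pz lz); apply; rewrite -yz.
by apply: connect_mono yr => a b /and3P[].
Qed.

(** The validity test loses no tree: blocked vertices lead to [u] by links, so by [descendant_cut]
    none of them lies on the route of [H] from [y] to the root. *)
Lemma parent_valid H u s fs y : minimal_steiner_tree G W H -> growing u s fs ->
  compatible H fs -> parent r H u y -> valid s (u :: verts fs) y.
Proof.
move=> Hmin gr Hc [_]; rewrite /valid (sym_connect_sym (avoid_sym _)).
have unblk z : connect (rel_minus (adjin H) u) z r -> ~~ blocked s (u :: verts fs) z.
  move=> zr; apply/negP => /(gr_path gr) /(descendant_cut Hmin gr Hc).
  by rewrite zr.
case/connectP=> p; elim: p y => [|z p IH] y /=; first by move=> _ ->.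
case/andP=> yz pz lz.
have zr : connect (rel_minus (adjin H) u) z r by apply/connectP; exists p.
apply: connect_trans (IH _ pz lz); apply: connect1; rewrite /avoid.
rewrite (unblk z) // (unblk y) ?(connect_trans (connect1 yz)) //= andbT.
by case/and3P: yz => /(minimal_adj Hmin).
Qed.

(** * Completed choices are minimal Steiner trees *)

Definition subgraph_of fs : vesets T :=
  ([set x in r :: verts fs], [set [set a.1; a.2] | a in map chosen fs]).

Lemma subgraph_of_adjin fs x y :
  adjin (subgraph_of fs) x y -> link fs x y \/ link fs y x.
Proof.
case/imsetP=> -[a b] ab /= eqs.
have := set21 x y; have := set22 x y; rewrite eqs.
case: (eqVneq x y) => [xy|nxy].
  subst y; have := set21 a b; have := set22 a b; rewrite -eqs !inE !orbb.
  by move=> /eqP eb /eqP ea; subst a b; left.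
rewrite !inE => /orP[]/eqP ye /orP[]/eqP xe; move: nxy; rewrite xe ye ?eqxx // => _.
- by right.
- by left.
Qed.

Lemma link_adjin fs x y : link fs x y -> adjin (subgraph_of fs) x y.
Proof. by move=> xy; apply/imsetP; exists (x, y). Qed.

Section Complete.
Variable fs : seq frame.
Hypotheses (ar : arrived fs) (done : {subset W <= r :: verts fs}).

Lemma subgraph_of_steiner : steiner_subgraph G W (subgraph_of fs).
Proof.
apply/(steiner_subgraphP G rW); split.
  split=> [|e]; first apply/subsetP=> e.
    by case/imsetP=> -[x y] xy ->; case: (ar_link ar xy).
  case/imsetP=> -[x y] xy ->; have [_ h1 h2] := ar_link ar xy.
  apply/subsetP=> z; rewrite in_set2 in_set => /orP[]/eqP-> //.
  by rewrite inE h1 orbT.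
move=> w /done wv; rewrite inE wv /=.
by apply: connect_mono (ar_tree ar wv) => x y; apply: link_adjin.
Qed.

Lemma not_from_root x : ~~ link fs r x.
Proof.
by apply/negP => /(ar_link ar) [_ h _]; move: (ar_uniq ar); rewrite /= h.
Qed.

(* Only the link of [x] leaves the set of descendants of [x]. *)
Lemma subgraph_of_minimal : minimal_steiner_tree G W (subgraph_of fs).
Proof.
split=> [|K [Ksub sV sE neq] Kst]; first exact: subgraph_of_steiner.
apply: neq; move/(steiner_subgraphP G rW): Kst => [[_ cK] hW].
have edgeK x y : link fs x y -> adjin K x y.
  move=> xy; have [_ xv _] := ar_link ar xy.
  (* A terminal among the descendants of [x]; its connection to the root inside [K] has to leave
     them somewhere. *)
  have [w wW wx] := ar_term ar xv; have /andP[_ wr] := hW _ wW.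
  have nr : ~~ connect (link fs) r x.
    apply/negP => /connectP[[|z p]] /=; last by rewrite (negPf (not_from_root z)).
    by move=> _ xr; move: (ar_uniq ar); rewrite -xr /= xv.
  have [a [b [ab Da Db]]] := connect_cross (D := fun z => connect (link fs) z x) wr wx nr.
  have /subgraph_of_adjin[lab|lba] : adjin (subgraph_of fs) a b by apply: (subsetP sE).
    have uv : uniq (verts fs) by case/andP: (ar_uniq ar).
    case/connectP: Da => -[|c p] /=.
      by move=> _ xa; rewrite xa in xy *; rewrite (link_inj uv xy lab).
    case/andP=> ac pc lc; case/negP: Db; rewrite (link_inj uv lab ac).
    by apply/connectP; exists p.
  by case/negP: Db; apply: connect_trans Da; apply: connect1.
rewrite [K]surjective_pairing; congr (_, _).
  apply/eqP; rewrite eqEsubset sV; apply/subsetP=> x; rewrite inE.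
  rewrite inE => /orP[/eqP->|]; first by case/andP: (hW _ rW).
  case/verts_link=> y xl.
  by apply: (subsetP (cK _ (edgeK _ _ xl))); apply: set21.
apply/eqP; rewrite eqEsubset sE; apply/subsetP=> e.
by case/imsetP=> -[x y] xy ->; apply: edgeK.
Qed.

Lemma subgraph_of_compatible : compatible (subgraph_of fs) fs.
Proof.
move=> x y xy; have [_ xv _] := ar_link ar xy; split; first exact: link_adjin.
have xr : connect (link fs) x r by apply: (ar_tree ar); rewrite inE xv orbT.
have nxr : x != r.
  by apply: contraTneq xy => ->; apply: not_from_root.
have [z xz zr] := connect_step_avoid xr nxr.
have uv : uniq (verts fs) by case/andP: (ar_uniq ar).
rewrite (link_inj uv xy xz).
by apply: connect_mono zr => a b /and3P[/link_adjin h1 h2 h3]; apply/and3P.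
Qed.

(** The chosen subgraph is itself a Steiner subgraph and lies inside [H], so the minimality of [H]
    leaves no room between them. *)
Lemma compatible_complete H : minimal_steiner_tree G W H -> compatible H fs ->
  H = subgraph_of fs.
Proof.
move=> [Hst Hmin] Hc; apply/eqP/negPn/negP => /eqP neq.
have [[sH cH] hW] := (steiner_subgraphP G rW H).1 Hst.
apply: (Hmin (subgraph_of fs)); last exact: subgraph_of_steiner.
have sE : (subgraph_of fs).2 \subset H.2.
  by apply/subsetP=> e; case/imsetP=> -[x y] /Hc[xy _] ->.
split=> //; first by case: subgraph_of_steiner.
  apply/subsetP=> x; rewrite inE inE => /orP[/eqP->|].
    by case/andP: (hW _ rW).
  case/verts_link=> y xl.
  by apply: (subsetP (cH _ (subsetP sE _ (link_adjin xl)))); apply: set21.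
by move=> e; apply: neq.
Qed.

(** Different arcs could only give the same edge by being opposite. Then [{x, y}] would be closed
    under links and never lead to the root. *)
Lemma chosen_edges_uniq : uniq [seq [set a.1; a.2] | a <- map chosen fs].
Proof.
have uv : uniq (verts fs) by case/andP: (ar_uniq ar).
rewrite map_inj_in_uniq; first by apply: (@map_uniq _ _ fst); rewrite -map_comp.
move=> [x y] [x' y'] xy xy' /= eqs.
have ny : x != y by case: (ar_link ar xy) => /adj_neq.
case: (eqVneq x x') => [xx|nx].
  by subst x'; rewrite (link_inj uv xy xy').
have [ex ey] : x = y' /\ y = x'.
  have := set21 x y; have := set22 x y; rewrite eqs !inE (negPf nx) /=.
  move=> hy /eqP xe; split=> //; move: hy; rewrite -xe.
  by case/orP=> /eqP yx //; rewrite yx eqxx in ny.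
subst x' y'; have [_ xv _] := ar_link ar xy.
have xr : connect (link fs) x r by apply: (ar_tree ar); rewrite inE xv orbT.
have nr : ~~ ((r == x) || (r == y)).
  apply/norP; split; apply/eqP => rr.
    by move: xy (not_from_root y); rewrite -rr /link => ->.
  by move: xy' (not_from_root x); rewrite -rr /link => ->.
have [|a [b [ab Da Db]]] := connect_cross (D := fun z => (z == x) || (z == y)) xr _ nr.
  by rewrite eqxx.
by move: Da Db => /orP[]/eqP ea; subst a; rewrite ?(link_inj uv ab xy)
  ?(link_inj uv ab xy') eqxx ?orbT.
Qed.

End Complete.

(** * The abstract machine and the number of its steps between outputs *)

Local Arguments position : simpl never.

(** The fold keeps the last candidate, as does [prog_terminal], whose loop overwrites a register and
    has no early exit. *)
Definition next_terminal fs : option T :=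
  foldl (fun o w => if position r (verts fs) w == 0 then Some w else o) None ws.

Lemma next_terminal_some fs w : next_terminal fs = Some w ->
  w \in W /\ position r (verts fs) w = 0.
Proof.
rewrite /next_terminal -wsP.
have : forall l o, (if o is Some x then x \in ws /\ position r (verts fs) x = 0
                    else True) -> {subset l <= ws} ->
    foldl (fun o w => if position r (verts fs) w == 0 then Some w else o) o l = Some w ->
    w \in ws /\ position r (verts fs) w = 0.
  elim=> [|x l IH] o ho sub /=; first by move=> eo; rewrite eo in ho.
  apply: IH; last by move=> y yl; apply: sub; rewrite inE yl orbT.
  by case: eqP => // px; split=> //; apply: sub; rewrite inE eqxx.
by apply.
Qed.

Lemma next_terminal_none fs : next_terminal fs = None -> {subset W <= r :: verts fs}.
Proof.
rewrite /next_terminal => h w; rewrite -wsP -position_gt0 lt0n => ww.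
apply/negP => pw; move: h.
have : forall l o, (o != None) || (w \in l) ->
  foldl (fun o w => if position r (verts fs) w == 0 then Some w else o) o l <> None.
  elim=> [|x l IH] o /=; first by rewrite orbF => /eqP.
  rewrite inE => /or3P[o0|/eqP<-|wl]; apply: IH.
  - by case: ifP; rewrite ?o0.
  - by rewrite pw.
  - by rewrite wl orbT.
by apply; rewrite ww orbT.
Qed.

(** The flag tells whether the current path has just reached the tree. *)
Definition config := (bool * seq frame)%type.
Implicit Types c : config.

(** After an output, as after a pop, the top frame simply resumes its scan at the stored pointer.
    The halting configuration [(false, [::])] is a fixed point. *)
Definition mstep c : config :=
  match c with
  | (true, fs) =>
      if next_terminal fs is Some w then (false, (w, (size fs).+1, 0) :: fs)
      else (false, fs)
  | (false, (u, s, p) :: fs) =>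
      if scan (okarc u s fs) (size arcs - p) p is Some q then
        let v := (nth (r, r) arcs q.-1).2 in
        if position r (u :: verts fs) v == 0
        then (false, (v, s, 0) :: (u, s, q) :: fs)
        else (true, (u, s, q) :: fs)
      else (false, fs)
  | _ => c
  end.

Definition mout c : seq (seq frame) :=
  if c.1 && (next_terminal c.2 == None) then [:: c.2] else [::].

Definition mouts N c : seq (seq frame) := flatten (map mout (traject mstep c N)).

Lemma mouts_cat N N' c : mouts (N + N') c = mouts N c ++ mouts N' (iter N mstep c).
Proof. by rewrite /mouts trajectD map_cat flatten_cat. Qed.

Fixpoint stack_growing fs : Prop :=
  if fs is (u, s, p) :: fs' then growing u s fs' /\ stack_growing fs' else True.

Record minv c : Prop := MInv {
  mi_stack : stack_growing c.2;
  mi_ptr : all (fun f => f.2 <= size arcs) c.2;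
  mi_arrived : c.1 -> arrived c.2
}.

Lemma minv_scan u s p fs q : minv (false, (u, s, p) :: fs) ->
  scan (okarc u s fs) (size arcs - p) p = Some q ->
  [/\ growing u s fs, p < q <= size arcs, (nth (r, r) arcs q.-1).1 = u
    & valid s (u :: verts fs) (nth (r, r) arcs q.-1).2].
Proof.
case=> /= [[gr st]] /andP[hp hps] _ /scan_some [/andP[/eqP au av] hq _].
by split=> //; lia.
Qed.

Lemma minv_step c : minv c -> minv (mstep c).
Proof.
case: c => -[] fs; last case: fs => [|[[u s] p] fs] inv //=.
- move=> [/= st pt /(_ isT) ar]; case E: next_terminal => [w|] //=.
  have [wW pw] := next_terminal_some E; split=> //=; split=> //.
  exact: arrived_growing.
- case E: scan => [q|]; last first.
    by move: inv => [/= [gr st] /andP[_ pt] _]; split.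
  have [gr hq au av] := minv_scan inv E.
  move: inv => [/= [_ st] /andP[_ pt] _].
  have hq' : 0 < q <= size arcs by lia.
  case: eqP => pv; split=> //=; rewrite ?pt ?andbT; try by lia.
    by split=> //; apply: growing_growing.
  by move=> _; apply: growing_arrived => //; apply/eqP.
Qed.

Lemma minv_size c : minv c -> size c.2 < #|T|.
Proof.
move=> [st _ _]; have un : uniq (r :: verts c.2).
  case: c st => _ [|[[u s] p] fs] //= [gr _]; exact: gr_uniq gr.
by rewrite -(size_map (fun f => f.1.1)) -/(size (r :: _)) -(card_uniqP un) max_card.
Qed.

(** Bounds the number of steps before the next output. *)
Definition potential c : nat :=
  match c with
  | (true, fs) => 2 * (#|T| - size fs) + 1
  | (false, (_, _, 0) :: fs) => 2 * (#|T| - size fs)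
  | (false, fs) => 2 * #|T| + 2 + size fs
  end.

Lemma potential_le c : minv c -> potential c <= 3 * #|T| + 2.
Proof.
move/minv_size; case: c => -[] [|[[u s] [|p]] fs] /=; lia.
Qed.

(** By [growing_okarc] a fresh frame is never popped: it descends, and a level of the stack costs at
    most two steps, one to start at a terminal and one to extend. Frames with a positive pointer may
    be popped; the offset [2 * #|T| + 2] ranks them above every descending configuration. *)
Lemma potential_step c : minv c -> c <> (false, [::]) -> mout c = [::] ->
  potential (mstep c) < potential c.
Proof.
move=> inv; move: (minv_size inv) (minv_size (minv_step inv)).
case: c inv => -[] fs.
  move=> inv sz; rewrite /mout /=; case: next_terminal => //= w sz' _ _; lia.
case: fs => [|[[u s] p] fs] inv //= sz.
case E: scan => [q|].
  have [gr hq _ _] := minv_scan inv E.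
  case: eqP => _ /= sz' _ _; case: (p) => [|p'] /=; try lia.
move=> sz' _ _; move: inv => [/= [gr _] _ _].
case: p E => [|p'] E /=.
  have [i ia ok] := growing_okarc gr.
  by have := scan_none E (i := i); rewrite ok; move=> /(_ _)/negP[]//; lia.
case: fs gr {E sz sz'} => [|[[u' s'] [|p]] fs] gr /=; try lia.
Qed.

(** Repetitions are excluded among trees and not merely among stacks, since different stacks might a
    priori describe the same tree. *)
Definition explores c c' (P : vesets T -> Prop) : Prop :=
  exists N, [/\ iter N mstep c = c', uniq (map subgraph_of (mouts N c)),
                forall H, H \in map subgraph_of (mouts N c) <-> P H
              & {in mouts N c, forall fs, arrived fs /\ {subset W <= r :: verts fs}}].

Lemma explores_eq c c' (P P' : vesets T -> Prop) :
  (forall H, P H <-> P' H) -> explores c c' P -> explores c c' P'.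
Proof.
by move=> h [N [h1 h2 h3 h4]]; exists N; split=> // H; rewrite h3.
Qed.

Lemma explores_step c c' P : mout c = [::] -> explores (mstep c) c' P ->
  explores c c' P.
Proof.
move=> o [N [h1 h2 h3 h4]]; exists N.+1.
have -> : mouts N.+1 c = mouts N (mstep c) by rewrite /mouts /= o.
by split=> //; rewrite iterSr.
Qed.

Lemma explores_trans c c' c'' (P P' : vesets T -> Prop) :
  explores c c' P -> explores c' c'' P' -> (forall H, P H -> P' H -> False) ->
  explores c c'' (fun H => P H \/ P' H).
Proof.
move=> [N [h1 h2 h3 h4]] [N' [g1 g2 g3 g4]] dis; exists (N' + N).
rewrite iterD h1 g1 addnC mouts_cat h1 map_cat; split=> //.
- rewrite cat_uniq h2 g2 andbT; apply/hasPn => H /g3 PH'; apply/negP => /h3 PH.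
  exact: dis PH PH'.
- by move=> H; rewrite mem_cat -h3 -g3; split=> [/orP|[]->]; rewrite ?orbT.
- by move=> fs; rewrite mem_cat => /orP[/h4|/g4].
Qed.

Definition target fs H : Prop := minimal_steiner_tree G W H /\ compatible H fs.

(** The outer induction is on the room [k] left on the stack, the inner one on the arcs still to be
    tried at [u]. A frame with pointer [p] is responsible for the compatible trees whose parent arc
    at [u] has index at least [p]. *)
Lemma explore_rec k :
  (forall u s p fs, minv (false, (u, s, p) :: fs) -> #|T| <= size fs + k ->
     explores (false, (u, s, p) :: fs) (false, fs) (fun H => target fs H /\
       exists2 i, p <= i < size arcs &
         (nth (r, r) arcs i).1 = u /\ parent r H u (nth (r, r) arcs i).2)) /\
  (forall fs, minv (true, fs) -> #|T| <= size fs + k ->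
     explores (true, fs) (false, fs) (target fs)).
Proof.
elim: k => [|k [IHg IHa]].
  by split=> [u s p fs|fs] /minv_size /= sz; lia.
have P_gr : forall u s p fs, minv (false, (u, s, p) :: fs) -> #|T| <= size fs + k.+1 ->
     explores (false, (u, s, p) :: fs) (false, fs) (fun H => target fs H /\
       exists2 i, p <= i < size arcs &
         (nth (r, r) arcs i).1 = u /\ parent r H u (nth (r, r) arcs i).2).
  move=> u s p fs inv sz.
  have [l hl] := ubnP (size arcs - p); elim: l p hl inv => // l IHl p hl inv.
  have [/= [gr st] /andP[_ ptr] _] := inv.
  case E: (scan (okarc u s fs) (size arcs - p) p) => [q|]; last first.
    exists 1; rewrite /= E /mouts /=; split=> // H; split=> //.
    (* By [parent_valid] the parent arc of [u] in such a tree would pass the test, against the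
       failure of the scan. *)
    move=> [[Hmin Hc] [i hi [au pu]]]; have := scan_none E (i := i).
    rewrite /okarc au eqxx (parent_valid Hmin gr Hc pu) => /(_ _)/negP[]//; lia.
  have [_ hq au av] := minv_scan inv E.
  have [_ _ before] := scan_some E.
  have inv1 := minv_step inv; set c1 := mstep _ in inv1.
  have ex1 : explores c1 (false, (u, s, q) :: fs) (target ((u, s, q) :: fs)).
    move: inv1; rewrite /c1 /= E; case: eqP => pv inv1; last first.
      by apply: IHa => //=; rewrite addSnnS.
    apply: explores_eq (IHg _ _ _ _ inv1 _); last by rewrite /= addSnnS.
    (* For a fresh pointer the clause on [i] is no restriction: the new tip is not the root, hence
       has a parent in [H], and the arc to it has some index. *)
    move=> H; split=> [[]//|[Hmin Hc]]; split=> //.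
    have pu : parent r H u (nth (r, r) arcs q.-1).2.
      by apply: Hc; rewrite /link inE /chosen eqxx.
    have nr : (nth (r, r) arcs q.-1).2 != r.
      apply: contra_eq_neq pv => ->; rewrite -lt0n position_gt0; exact: mem_head.
    have [y yp] := parent_exists nr (parent_connect pu).
    have yin : ((nth (r, r) arcs q.-1).2, y) \in arcs.
      by rewrite arcsP; case: yp => /(minimal_adj Hmin).
    by exists (index ((nth (r, r) arcs q.-1).2, y) arcs); rewrite ?index_mem // nth_index.
  have inv2 : minv (false, (u, s, q) :: fs) by split=> //=; rewrite ptr; lia.
  have ex2 := IHl q _ inv2.
  apply: explores_step => //; apply: explores_eq (explores_trans ex1 (ex2 _) _).
  - move=> H; rewrite /target compatible_cons /chosen /=.
    split=> [[[Hmin [pu Hc]]|[[Hmin Hc] [i hi ip]]]|[[Hmin Hc] [i hi [ai pi]]]].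
    + by split=> //; exists q.-1; [lia | rewrite au].
    + by split=> //; exists i => //; lia.
    + case: (ltngtP i q.-1) => iq.
      * have := before i; rewrite /okarc ai eqxx (parent_valid Hmin gr Hc pi).
        by move=> /(_ _)/negP[]//; lia.
      * by right; split=> //; exists i => //; lia.
      * by left; split=> //; split=> //; rewrite -iq.
  - by lia.
  (* The two families are disjoint: [u] has one parent and [arcs] no repetitions, so the index of
     its parent arc cannot be both [q.-1] and at least [q]. *)
  - move=> H [Hmin]; rewrite compatible_cons /chosen /= => -[pu _] [_ [i hi [ai pi]]].
    have /eqP : nth (r, r) arcs q.-1 = nth (r, r) arcs i.
      have := parent_inj rW Hmin pu pi; move: au ai.
      by case: (nth _ _ q.-1) (nth _ _ i) => [a b] [a' b'] /= -> -> ->.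
    have [qa ia] : q.-1 < size arcs /\ i < size arcs by split; [lia|case/andP: hi].
    by rewrite nth_uniq // => /eqP; lia.
split=> // fs inv sz; have [_ _ /(_ isT) /= ar] := inv.
case E: (next_terminal fs) => [w|]; last first.
  have done := next_terminal_none E.
  exists 1; rewrite /= E /mouts /= cats0 /mout /= E eqxx; split=> //.
    move=> H; rewrite inE; split=> [/eqP->|[]]; last first.
      by move=> Hmin Hc; apply/eqP; apply: compatible_complete.
    by split; [apply: subgraph_of_minimal | apply: subgraph_of_compatible].
  by move=> fs'; rewrite inE => /eqP->.
have [wW pw] := next_terminal_some E; have inv1 := minv_step inv.
apply: explores_step; first by rewrite /mout /= E.
move: inv1; rewrite /= E => inv1; apply: explores_eq (P_gr _ _ _ _ inv1 sz).
move=> H; split=> [[]//|[Hmin Hc]]; split=> //.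
have nr : w != r.
  apply: contra_eq_neq pw => ->; rewrite -lt0n position_gt0; exact: mem_head.
have [y yp] := parent_exists nr (minimal_connect rW Hmin wW).
have yin : (w, y) \in arcs by rewrite arcsP; case: yp => /(minimal_adj Hmin).
by exists (index (w, y) arcs); rewrite ?index_mem // nth_index.
Qed.

Lemma minv_init : minv (true, [::]).
Proof.
split=> //= _; split=> //= x; rewrite inE => /eqP->; exact: connect0.
Qed.

Lemma explore_all :
  explores (true, [::]) (false, [::]) (minimal_steiner_tree G W).
Proof.
have [_ h] := explore_rec #|T|; apply: explores_eq (h [::] minv_init _) => //.
by move=> H; split=> [[]//|]; split.
Qed.

End Machine.

(** * The program *)

Notation rNone := 0 (only parsing).
Notation rN := 1 (only parsing).
Notation rM := 2 (only parsing).
Notation rK := 3 (only parsing).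
Notation rBase := 4 (only parsing).
Notation rRoot := 5 (only parsing).
Notation rD := 6 (only parsing).
Notation rMode := 7 (only parsing).
Notation rI := 8 (only parsing).
Notation rX := 9 (only parsing).
Notation rY := 10 (only parsing).
Notation rU := 11 (only parsing).
Notation rS := 12 (only parsing).
Notation rP := 13 (only parsing).
Notation rQI := 14 (only parsing).
Notation rQN := 15 (only parsing).
Notation rP2 := 16 (only parsing).
Notation rF := 17 (only parsing).
Notation rW := 18 (only parsing).

(** The working memory behind the input consists of ten interleaved arrays; entry
    [i] of array [f] is at offset [10 * i + f]. *)
Notation fHead := 0 (only parsing).
Notation fNext := 1 (only parsing).
Notation fSrc := 2 (only parsing).
Notation fDst := 3 (only parsing).
Notation fPos := 4 (only parsing).
Notation fMark := 5 (only parsing).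
Notation fQueue := 6 (only parsing).
Notation fVert := 7 (only parsing).
Notation fStart := 8 (only parsing).
Notation fPtr := 9 (only parsing).

Declare Scope ram_scope.
Delimit Scope ram_scope with ram.
Notation "a [+] b" := (Op Add a b) (at level 50, left associativity) : ram_scope.
Notation "a [-] b" := (Op Sub a b) (at level 50, left associativity) : ram_scope.
Notation "a [*] b" := (Op Mul a b) (at level 40, left associativity) : ram_scope.
Notation "a [/] b" := (Op Div a b) (at level 40, left associativity) : ram_scope.
Notation "a [==] b" := (Op Eq a b) (at level 70) : ram_scope.
Notation "a [<] b" := (Op Lt a b) (at level 70) : ram_scope.
Notation "a ;; b" := (Seq a b) (at level 90, right associativity) : ram_scope.
Notation "x <~ e" := (Assign x e) (at level 80) : ram_scope.
Notation "# k" := (Const k) (at level 1, format "# k") : ram_scope.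
Notation "$ x" := (Reg x) (at level 1, format "$ x") : ram_scope.
Local Open Scope ram_scope.

Definition addr (f : nat) (e : expr) : expr := $rBase [+] (#10 [*] e [+] #f).
Definition get (f : nat) (e : expr) : expr := Read (addr f e).
Definition put (f : nat) (e v : expr) : cmd := Write (addr f e) v.
Definition skip : cmd := rNone <~ #0.

Definition prog_clear : cmd :=
  rI <~ #0 ;;
  While ($rI [<] $rN) (put fMark $rI #0 ;; rI <~ $rI [+] #1).

(** [rP2] is one more than the arc under examination; 0 means that the current list is exhausted and
    a vertex has to be fetched from the queue. The sum in the inner test acts as a disjunction:
    marked or blocked. *)
Definition search_body : cmd :=
  If ($rP2 [==] #0)
     (rX <~ get fQueue $rQI ;; rP2 <~ get fHead $rX ;; rQI <~ $rQI [+] #1)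
     (rI <~ $rP2 [-] #1 ;; rY <~ get fDst $rI ;;
      If (get fMark $rY [+] ($rS [<] get fPos $rY) [==] #0)
         (put fMark $rY #1 ;; put fQueue $rQN $rY ;; rQN <~ $rQN [+] #1)
         skip ;;
      rP2 <~ get fNext $rI).

(** Breadth-first search from the root that avoids the vertices whose position
    exceeds register [rS].  Vertices and arcs are handled in the same loop. *)
Definition prog_search : cmd :=
  prog_clear ;;
  (put fMark $rRoot #1 ;; put fQueue #0 $rRoot ;;
   rQI <~ #0 ;; rQN <~ #1 ;; rP2 <~ #0) ;;
  While (($rQI [<] $rQN) [+] $rP2) search_body.

Definition prog_scan : cmd :=
  rF <~ #0 ;;
  While (($rP [<] $rM) [*] ($rF [==] #0))
    (If (get fSrc $rP [==] $rU)
        (If (get fMark (get fDst $rP)) (rF <~ #1) skip) skip ;;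
     rP <~ $rP [+] #1).

(** [rD] is incremented before [s] is evaluated. With [$rD] for [s], the stored start is the new
    depth, which is the [(size fs).+1] of [mstep]. *)
Definition prog_push (v s : expr) : cmd :=
  rD <~ $rD [+] #1 ;; put fVert $rD v ;; put fStart $rD s ;; put fPtr $rD #0 ;;
  put fPos v ($rD [+] #1).

Definition prog_grow : cmd :=
  (rU <~ get fVert $rD ;; rS <~ get fStart $rD ;; rP <~ get fPtr $rD) ;;
  prog_search ;;
  prog_scan ;;
  If $rF
     (put fPtr $rD $rP ;; rX <~ get fDst ($rP [-] #1) ;;
      If (get fPos $rX) (rMode <~ #1) (prog_push $rX $rS))
     (put fPos $rU #0 ;; rD <~ $rD [-] #1).

Definition prog_terminal : cmd :=
  (rW <~ $rN ;; rI <~ #0) ;;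
  While ($rI [<] $rK)
    (rX <~ Read (#3 [+] $rM [+] $rI) ;;
     If (get fPos $rX) skip (rW <~ $rX) ;;
     rI <~ $rI [+] #1).

Definition prog_emit : cmd :=
  Emit ($rD [+] #1) ;;
  rI <~ #0 ;;
  While ($rI [<] $rD [+] #1) (Emit (get fVert $rI) ;; rI <~ $rI [+] #1) ;;
  rI <~ #1 ;;
  While ($rI [<] $rD [+] #1)
    (Emit (get fVert $rI) ;; Emit (get fDst (get fPtr $rI [-] #1)) ;;
     rI <~ $rI [+] #1).

Definition prog_arrive : cmd :=
  prog_terminal ;;
  If ($rW [<] $rN)
     (prog_push $rW $rD ;; rMode <~ #0)
     (prog_emit ;; Yield ;; rMode <~ #0).

Definition prog_loop : cmd :=
  While ($rD [+] $rMode) (If $rMode prog_arrive prog_grow).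

Definition prog_build : cmd :=
  rI <~ #0 ;;
  While ($rI [<] $rM)
    (rX <~ Read (#3 [+] $rI) ;;
     (* The other end of the edge: words [2j] and [2j + 1] form a pair with sum [4j + 1], where [j]
        is [i / 2]. *)
     rY <~ Read (#3 [+] (#4 [*] ($rI [/] #2) [+] #1 [-] $rI)) ;;
     put fSrc $rI $rX ;; put fDst $rI $rY ;;
     put fNext $rI (get fHead $rX) ;; put fHead $rX ($rI [+] #1) ;;
     rI <~ $rI [+] #1).

Definition prog : cmd :=
  (rN <~ Read #0 ;; rM <~ #2 [*] Read #1 ;; rK <~ Read #2 ;;
   rBase <~ #3 [+] $rM [+] $rK) ;;
  If $rK
     (prog_build ;;
      (rRoot <~ Read (#3 [+] $rM) ;; put fPos $rRoot #1 ;; put fVert #0 $rRoot ;;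
       rD <~ #0 ;; rMode <~ #1) ;;
      prog_loop)
     (Emit #0 ;; Yield).

(** * Memory layout and frame conditions *)

Section Ram.
Variables (B M n : nat) (r : 'I_n) (arcs : seq ('I_n * 'I_n)) (ws : seq 'I_n).
Let m2 := size arcs.
Let base := 3 + m2 + size ws.
Hypotheses (hB : base + 10 * (m2 + n).+2 <= B) (hM : base + 10 * (m2 + n).+2 <= M).
Hypothesis ws_le : size ws <= n.
Implicit Types (s : state).

Local Notation cell f i := (base + (10 * i + f)).

Definition const_regs (g : nat -> nat) : Prop :=
  [/\ g rN = n, g rM = m2, g rK = size ws, g rBase = base & g rRoot = r].

Record frame_of (F R : seq nat) s s' : Prop := FrameOf {
  fr_reg : forall x, x \notin R -> regs s' x = regs s x;
  fr_arr : forall f i, f < 10 -> f \notin F -> mem s' (cell f i) = mem s (cell f i);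
  fr_inp : forall i, i < base -> mem s' i = mem s i
}.

Lemma frame_sub F R F' R' s s' : {subset F <= F'} -> {subset R <= R'} ->
  frame_of F R s s' -> frame_of F' R' s s'.
Proof.
move=> sF sR [h1 h2 h3]; split=> [x xR|f i f10 fF|i ib]; last exact: h3.
- by apply: h1; apply: contra xR; apply: sR.
- by apply: h2 => //; apply: contra fF; apply: sF.
Qed.

Lemma frame_assign F R s g m x v :
  x \in R -> frame_of F R s (State g m) -> frame_of F R s (State (update g x v) m).
Proof.
move=> xR [h1 h2 h3]; split=> //= y yR; rewrite /update.
by case: eqP => [yx|_]; [rewrite yx xR in yR | exact: h1].
Qed.

Lemma mupdate_cell m f i v f' i' : f < 10 -> f' < 10 ->
  mupdate m (cell f i) v (cell f' i') =
  if (f' == f) && (i' == i) then v else m (cell f' i').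
Proof.
move=> hf hf'; rewrite /mupdate /update; congr (if _ then _ else _).
by apply/eqP/andP => [e|[/eqP-> /eqP->]//]; split; apply/eqP; lia.
Qed.

Lemma mupdate_inp m f i v j : j < base -> mupdate m (cell f i) v j = m j.
Proof. by move=> hj; rewrite /mupdate /update; case: eqP => // e; lia. Qed.

Lemma frame_write F R s g m f i v : f < 10 ->
  f \in F -> frame_of F R s (State g m) ->
  frame_of F R s (State g (mupdate m (cell f i) v)).
Proof.
move=> f10 fF [h1 h2 h3]; split=> //= [f' i' f10' fF'|j jb].
  rewrite mupdate_cell //; case: eqP => [e|_]; [by rewrite e fF in fF' | exact: h2].
by rewrite mupdate_inp //; apply: h3.
Qed.

Lemma const_regs_frame F R s s' : frame_of F R s s' ->
  all (fun x => ~~ (0 < x < 6)) R -> const_regs (regs s) -> const_regs (regs s').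
Proof.
move=> fr aR [h1 h2 h3 h4 h5].
have out x : 0 < x < 6 -> x \notin R.
  by move=> x6; apply/negP => /(allP aR) /=; rewrite x6.
by split; rewrite (fr_reg fr) // out.
Qed.

Ltac crush :=
  repeat match goal with
  | |- and3 _ _ _ => split
  | |- and4 _ _ _ _ => split
  | |- and _ _ => split
  | |- True => exact I
  end.

Tactic Notation "bounds" hyp_list(hs) :=
  crush; try match goal with
             |- is_true (leq _ _) => clear - hB hM ws_le hs; lia
             end.

Ltac frames := repeat first [ apply: frame_assign; [by [] |]
                            | apply: frame_write; [by [] | by [] |] ].

Lemma prog_clearP s : const_regs (regs s) ->
  hoare B M prog_clear s (30 * n.+1) [::] (fun s' =>
    frame_of [:: fMark] [:: rI] s s' /\ forall v : 'I_n, mem s' (cell fMark v) = 0).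
Proof.
case: s => g m [/= gN gM gK gB gR].
apply: (@hoare_seq _ _ _ _ _ 2 (24 * n + 6) _ [::] [::]) => //; last by lia.
apply: wp_hoare => //=; split; first by lia.
pose I k s' := [/\ frame_of [:: fMark] [:: rI] (State g m) s', k + regs s' rI = n
  & forall v, v < regs s' rI -> mem s' (cell fMark v) = 0].
apply: (@hoare_while _ _ _ _ I 20 _ n).
- by move=> k s' _ /=; have b := leq_b1 (regs s' rI < regs s' rN); bounds b.
- move=> k s' [fr hk hv] /=; rewrite (fr_reg fr (x := rN)) //= gN => h.
  split=> // v; apply: hv; have := ltn_ord v; lia.
- move=> k [g' m'] [fr /= hk hv]; have /= gE := fr_reg fr.
  rewrite (gE rN) //= gN => h; split; first by lia.
  apply: wp_hoare => //=; rewrite /update /=; rewrite !(gE rBase) //= gB.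
  have hi : g' rI < n by lia.
  bounds hi.
  split; first by frames.
    by rewrite /=; lia.
  move=> v /= hv'; rewrite mupdate_cell //=.
  by case: eqP => // ne; apply: hv; lia.
- by split=> //=; [frames | rewrite addn0].
- by rewrite /=; lia.
Qed.

(** * Adjacency lists in memory *)

Local Notation src i := (nth (r, r) arcs i).1.
Local Notation dst i := (nth (r, r) arcs i).2.

(** One more than the last arc before [j] that starts at [v], and 0 if there is
    none: the adjacency list of [v] is traversed backwards. *)
Fixpoint last_arc (v : 'I_n) (j : nat) : nat :=
  if j is i.+1 then if src i == v then j else last_arc v i else 0.

(** The work left in the list of [v] when its pointer is [j]; it measures the progress of the
    search. *)
Fixpoint out_arcs (v : 'I_n) (j : nat) : nat :=
  if j is i.+1 then (src i == v) + out_arcs v i else 0.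

Lemma last_arcP v j :
  [/\ last_arc v j <= j, out_arcs v (last_arc v j) = out_arcs v j,
      0 < last_arc v j -> src (last_arc v j).-1 = v
    & forall i, last_arc v j <= i < j -> src i != v].
Proof.
elim: j => [|j [IH1 IH2 IH3 IH4]] /=; first by split=> // i; lia.
case: (eqVneq (src j) v) => [e|ne] /=.
  by split=> //=; rewrite ?e ?eqxx // => i; lia.
split=> //; first by lia.
move=> i hi; case: (eqVneq i j) => [->//|nij]; apply: IH4; lia.
Qed.

Lemma sum_out_arcs j : \sum_v out_arcs v j = j.
Proof.
elim: j => [|j IH] /=; first by rewrite big1.
rewrite big_split /= IH (bigD1 (src j)) //= eqxx big1 // => v /negPf.
by rewrite eq_sym => ->.
Qed.

Record static (m : nat -> nat) : Prop := Static {
  st_src : forall i, i < m2 -> m (cell fSrc i) = src i;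
  st_dst : forall i, i < m2 -> m (cell fDst i) = dst i;
  st_next : forall i, i < m2 -> m (cell fNext i) = last_arc (src i) i;
  st_head : forall v : 'I_n, m (cell fHead v) = last_arc v m2;
  st_ws : forall i, i < size ws -> m (3 + m2 + i) = nth r ws i
}.

Lemma static_frame F R s s' : frame_of F R s s' -> all (ltn 3) F ->
  static (mem s) -> static (mem s').
Proof.
move=> fr aF [h1 h2 h3 h4 h5].
have out f : f < 4 -> f \notin F.
  by move=> f4; apply/negP => /(allP aF) /=; lia.
split=> [i im|i im|i im|v|i im]; rewrite ?(fr_arr fr) ?out //.
- exact: h1.
- exact: h2.
- exact: h3.
- by rewrite (fr_inp fr) ?h5 // /base; lia.
Qed.

(** * Breadth-first search from the root *)

Section Search.
Variables (G : graph 'I_n) (sp : nat) (vs : seq 'I_n).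
Hypothesis arcsP : forall x y, ((x, y) \in arcs) = adj G x y.
Hypotheses (r_vs : r \notin vs) (sp_gt0 : 0 < sp) (vs_size : size vs <= n).
Local Notation ok := (valid G r sp vs).
Local Notation blk := (blocked r sp vs).

(** [q] is everything ever queued, its prefix of length [rQI] has been fetched, and [x] is the
    vertex whose list is being read. The budget [k] charges each unfetched vertex one turn plus its
    arcs, reached or not; it starts at [m2 + n]. *)
Record search_inv s0 (q : seq 'I_n) (x : 'I_n) (k : nat) s : Prop := SearchInv {
  si_frame : frame_of [:: fMark; fQueue] [:: rNone; rI; rX; rY; rQI; rQN; rP2] s0 s;
  si_uniq : uniq q;
  si_qn : regs s rQN = size q;
  si_qi : regs s rQI <= size q;
  si_queue : forall i, i < size q -> mem s (cell fQueue i) = nth r q i;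
  si_mark : forall v : 'I_n, mem s (cell fMark v) = (v \in q);
  si_root : r \in q;
  si_valid : {in q, forall v, ok v};
  si_p2 : regs s rP2 <= m2;
  si_cur : 0 < regs s rP2 -> x \in take (regs s rQI) q /\ src (regs s rP2).-1 = x;
  si_closed : forall i, i < m2 -> src i \in take (regs s rQI) q ->
    [\/ src i = x /\ i < regs s rP2, blk (dst i) | dst i \in q];
  si_count : k = \sum_(v | v \notin take (regs s rQI) q) (out_arcs v m2).+1
                 + out_arcs x (regs s rP2)
}.

Lemma search_inv_init s0 s :
  frame_of [:: fMark; fQueue] [:: rNone; rI; rX; rY; rQI; rQN; rP2] s0 s ->
  regs s rQN = 1 -> regs s rQI = 0 -> regs s rP2 = 0 ->
  mem s (cell fQueue 0) = r -> (forall v : 'I_n, mem s (cell fMark v) = (v == r)) ->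
  search_inv s0 [:: r] r (m2 + n) s.
Proof.
move=> fr e1 e2 e3 e4 e5; split=> //; rewrite ?e1 ?e2 ?e3 //=.
- by case.
- by move=> v; rewrite e5 inE.
- exact: mem_head.
- by move=> v; rewrite inE => /eqP->; apply: connect0.
- rewrite addn0 (eq_bigl xpredT) // (eq_bigr (fun v => out_arcs v m2 + 1)).
    by rewrite big_split /= sum_out_arcs sum1_card card_ord.
  by move=> v _; rewrite addn1.
Qed.

(** With all of [q] fetched and no arc pending, [si_closed] says that [q] is closed under arcs to
    unblocked vertices; it contains the root. *)
Lemma search_inv_done s0 q x k s : search_inv s0 q x k s ->
  regs s rQI = regs s rQN -> regs s rP2 = 0 -> q =i ok.
Proof.
move=> inv e1 e2 v; apply/idP/idP; first exact: (si_valid inv).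
rewrite unfold_in => /connectP[p]; elim/last_ind: p v => [|p z IH] v /=.
  by move=> _ ->; apply: (si_root inv).
rewrite rcons_path last_rcons => /andP[pp /and3P[adj_z _ nb]] ->.
have zq : last r p \in q by apply: IH.
have az : (last r p, z) \in arcs by rewrite arcsP.
have iz : index (last r p, z) arcs < m2 by rewrite index_mem.
have := si_closed inv iz; rewrite nth_index //= e1 (si_qn inv) take_size e2.
by case=> // [[]//|b]; rewrite b in nb.
Qed.

Lemma search_bodyP s0 q x k s : const_regs (regs s0) -> static (mem s0) ->
  regs s0 rS = sp -> (forall v : 'I_n, mem s0 (cell fPos v) = position r vs v) ->
  search_inv s0 q x k s -> ((regs s rQI < regs s rQN) + regs s rP2)%N != 0 ->
  0 < k /\ hoare B M search_body s 110 [::] (fun s' =>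
             exists q' x', search_inv s0 q' x' k.-1 s').
Proof.
case: s => g m cr0 st0 s0S s0P inv; have fr := si_frame inv.
have [gN gM gK gB gR] := const_regs_frame fr isT cr0.
have st := static_frame fr isT st0.
have gS : g rS = sp by rewrite -s0S -(fr_reg fr).
have mP (v : 'I_n) : m (cell fPos v) = position r vs v by rewrite -s0P -(fr_arr fr).
have pos_le (v : 'I_n) : position r vs v <= n.+1.
  exact: leq_trans (position_le r vs v) _.
case: inv => /= _ uq qn qi mq mm rq vq p2 cur clos kE cond.
have sq : size q <= n by rewrite -(card_uniqP uq) -[X in _ <= X]card_ord max_card.
rewrite /= in gN gM gK gB gR st.
case: (posnP (g rP2)) => [e0|p2gt].
- have lt : g rQI < size q by move: cond; rewrite e0 qn; lia.
  pose y := nth r q (g rQI).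
  have [l1 l2 l3 l4] := last_arcP y m2.
  have yn : y \notin take (g rQI) q.
    by move: uq; rewrite -{1}(cat_take_drop (g rQI) q) (drop_nth r lt) cat_uniq /= negb_or
      => /and3P[_ /andP[]].
  have tk : take (g rQI).+1 q = rcons (take (g rQI) q) y by rewrite (take_nth r lt).
  have kE' : k = (\sum_(v | v \notin take (g rQI).+1 q) (out_arcs v m2).+1
                 + out_arcs y (last_arc y m2)).+1.
    rewrite kE e0 addn0 (bigD1 y) //= l2 addSn addnC; congr (_ + _).+1.
    by apply: eq_bigl => v; rewrite tk mem_rcons inE negb_or andbC.
  split; first by lia.
  apply: wp_hoare => //=; rewrite /update /= !gB.
  have ey : m (cell fQueue (g rQI)) = y by rewrite mq.
  have yn' := ltn_ord y.
  rewrite !ey !(st_head st) e0.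
  have iB : g rQI <= n by lia.
  bounds iB yn'; last by [].
  move=> _; bounds iB yn'.
  exists q, y; split=> //=; rewrite ?addn1 //.
  + by frames.
  + by rewrite tk mem_rcons mem_head; split=> //; apply: l3.
  + move=> i im; rewrite tk mem_rcons inE => /orP[/eqP si|/(clos _ im)].
      by apply: Or31; split=> //; rewrite ltnNge; apply/negP => le;
        have := l4 i; rewrite si eqxx => /(_ _)/negP[]//; rewrite le im.
    by case=> [[_]|b|d]; [rewrite e0 | apply: Or32 | apply: Or33].
  + by rewrite kE'.
- have [xt sx] := cur p2gt; set j := (g rP2).-1 in sx.
  have jP : g rP2 = j.+1 by rewrite /j prednK.
  have jm : j < m2 by lia.
  pose y := dst j; have yn := ltn_ord y.
  have [l1 l2 l3 l4] := last_arcP x j.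
  have kE' : k = (\sum_(v | v \notin take (g rQI) q) (out_arcs v m2).+1
                 + out_arcs x (last_arc x j)).+1.
    by rewrite kE jP /= sx eqxx l2 addnCA.
  split; first by lia.
  have ej : g rP2 - 1 = j by rewrite jP subn1.
  have ey : m (cell fDst j) = y by rewrite (st_dst st).
  have enx : m (cell fNext j) = last_arc x j by rewrite (st_next st) // sx.
  have xq : x \in q by apply: mem_take xt.
  (* The pointer drops from [j.+1] to [last_arc x j]. Of the arcs passed over, [j] is settled by the
     hypothesis on [y], and the others do not start at [x]. *)
  have clos' (q' : seq 'I_n) : {subset q <= q'} -> (y \in q') || blk y -> forall i, i < m2 ->
      src i \in take (g rQI) q ->
      [\/ src i = x /\ i < last_arc x j, blk (dst i) | dst i \in q'].
    move=> sub yq' i im si; case: (clos _ im si) => [[ix]|b|d].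
    - rewrite jP ltnS leq_eqVlt => /orP[/eqP ij|ij].
        by rewrite -/y ij; case/orP: yq'; [apply: Or33 | apply: Or32].
      case: (ltnP i (last_arc x j)) => il; first by apply: Or31.
      by have := l4 i; rewrite il ij ix eqxx => /(_ isT).
    - exact: Or32.
    - by apply: Or33; apply: sub.
  apply: wp_hoare => //=; rewrite /update /= !gB !ej !ey !mm !mP !gS.
  have pl := pos_le y; have b0 := leq_b1 (g rP2 == 0).
  have b1 := leq_b1 (y \in q); have b2 := leq_b1 (sp < position r vs y).
  have b3 := leq_b1 ((y \in q) + (sp < position r vs y) == 0).
  bounds b0; first by rewrite jP.
  move=> _; bounds jm yn b1 b2 b3 pl.
  + move=> unm; have yq : y \notin q by apply: contraNN unm => ->.
    have by_ : ~~ blk y by apply: contraNN unm; rewrite /blocked => ->; rewrite addn1.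
    have uq' : uniq (rcons q y) by rewrite rcons_uniq yq.
    (* The queue stays without repetitions when [y] is added, so it cannot outgrow its array. *)
    have sq' : size q < n.
      by have := max_card (ssrbool.mem (rcons q y)); rewrite (card_uniqP uq') size_rcons card_ord.
    rewrite !qn !mupdate_cell //= enx; bounds jm yn sq'.
    have tq : take (g rQI) (rcons q y) = take (g rQI) q by rewrite -cats1 takel_cat.
    exists (rcons q y), x; split=> //=; rewrite ?size_rcons ?tq ?addn1 //.
    * by frames.
    * exact: leqW.
    * move=> i; rewrite ltnS nth_rcons mupdate_cell //= mupdate_cell //=.
      by case: ltngtP => // lt _; apply: mq.
    * move=> v; rewrite mupdate_cell //= mupdate_cell //= mem_rcons inE.
      by rewrite val_eqE; case: eqP => //= _; rewrite mm.
    * by rewrite mem_rcons inE rq orbT.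
    * move=> v; rewrite mem_rcons inE => /orP[/eqP->|/vq//].
      apply: connect_trans (vq _ xq) (connect1 _); apply/and3P; split=> //.
        by rewrite -arcsP -sx -surjective_pairing mem_nth.
      exact: valid_unblocked (vq _ xq).
    * exact: leq_trans l1 (ltnW jm).
    * by move=> h; split=> //; apply: l3.
    * apply: (clos' (rcons q y)); rewrite ?mem_rcons ?mem_head // => z zq.
      by rewrite mem_rcons inE zq orbT.
    * by rewrite kE'.
  + move=> mk; bounds jm.
    exists q, x; split=> //=; rewrite ?enx //.
    * by frames.
    * exact: leq_trans l1 (ltnW jm).
    * by move=> h; split=> //; apply: l3.
    * apply: (clos' q) => //; case: (y \in q) mk => //=.
      by rewrite add0n /blocked; case: (sp < _).
    * by rewrite kE'.
Qed.

Lemma prog_searchP s : const_regs (regs s) -> static (mem s) ->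
  regs s rS = sp -> (forall v : 'I_n, mem s (cell fPos v) = position r vs v) ->
  hoare B M prog_search s (200 * (m2 + n).+1) [::] (fun s' =>
    frame_of [:: fMark; fQueue] [:: rNone; rI; rX; rY; rQI; rQN; rP2] s s' /\
    forall v : 'I_n, mem s' (cell fMark v) = ok v).
Proof.
move=> cr st sS sP.
apply: (@hoare_seq _ _ _ _ _ (30 * n.+1) (130 * (m2 + n) + 100) _ [::] [::]) => //;
  last by lia.
apply: hoare_weak (prog_clearP cr) (leqnn _) _ => s1 [fr1 mk1].
have fr1' : frame_of [:: fMark; fQueue] [:: rNone; rI; rX; rY; rQI; rQN; rP2] s s1.
  by apply: frame_sub fr1 => x; rewrite !inE => /eqP->.
have [gN gM gK gB gR] := const_regs_frame fr1' isT cr.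
apply: (@hoare_seq _ _ _ _ _ 60 (130 * (m2 + n) + 20) _ [::] [::]) => //; last by lia.
have rn := ltn_ord r.
apply: wp_hoare => //=; rewrite /update /= !gB gR; bounds rn.
case: s1 fr1 fr1' mk1 gN gM gK gB gR => g m fr1 fr1' mk1 /= gN gM gK gB gR.
set s2 := State _ _.
have fr2 : frame_of [:: fMark; fQueue] [:: rNone; rI; rX; rY; rQI; rQN; rP2] s s2.
  by frames.
pose I k s' := exists q x, search_inv s q x k s'.
apply: (@hoare_while _ _ _ _ I 110 _ (m2 + n)).
- move=> k [g' m'] [q [x inv]] /=; have := si_p2 inv => /= p2.
  have b1 := leq_b1 (g' rQI < g' rQN); bounds b1 p2.
- move=> k s' [q [x inv]] /= c0; split; first exact: si_frame inv.
  have e2 : regs s' rP2 = 0 by lia.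
  have e1 : regs s' rQI = regs s' rQN.
    by have := si_qi inv; have := si_qn inv; lia.
  by move=> v; rewrite (si_mark inv) (search_inv_done inv).
- by move=> k s' [q [x inv]] /= c0; apply: search_bodyP inv c0.
- exists [:: r], r; apply: search_inv_init => //=.
    by rewrite mupdate_cell //=.
  by move=> v; rewrite mupdate_cell //= mupdate_cell //= val_eqE; case: eqP => // _;
    apply: mk1.
- by rewrite /=; lia.
Qed.

End Search.

Lemma prog_scanP s (u : 'I_n) (ok : pred 'I_n) p :
  const_regs (regs s) -> static (mem s) -> regs s rU = u -> regs s rP = p ->
  p <= m2 -> (forall v : 'I_n, mem s (cell fMark v) = ok v) ->
  let res := scan (fun i => (src i == u) && ok (dst i)) (m2 - p) p in
  hoare B M prog_scan s (60 * m2.+1) [::] (fun s' =>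
    [/\ frame_of [::] [:: rNone; rF; rP] s s', regs s' rF = isSome res
      & forall q, res = Some q -> regs s' rP = q]).
Proof.
case: s => g m cr st /= gU gP pm mk; set P := (fun i : nat => _ && _).
apply: (@hoare_seq _ _ _ _ _ 5 (50 * m2 + 10) _ [::] [::]) => //; last by lia.
apply: wp_hoare => //=; split; first by lia.
set s1 := State _ _.
pose I k s' := [/\ frame_of [::] [:: rNone; rF; rP] (State g m) s', regs s' rP <= m2 &
  if regs s' rF == 0 then
    k = m2 - regs s' rP /\ scan P (m2 - regs s' rP) (regs s' rP) = scan P (m2 - p) p
  else regs s' rF = 1 /\ scan P (m2 - p) p = Some (regs s' rP)].
apply: (@hoare_while _ _ _ _ I 42 _ (m2 - p)).
- move=> k s' _ /=; have b1 := leq_b1 (regs s' rP < regs s' rM).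
  have b2 := leq_b1 (regs s' rF == 0).
  have b3 : (regs s' rP < regs s' rM) * (regs s' rF == 0) <= 1.
    exact: (@leq_mul _ _ 1 1).
  bounds b1 b2 b3.
- move=> k s' [fr hP] /=; have [_ gM _ _ _] := const_regs_frame fr isT cr.
  rewrite gM; case: eqP => [F0 [_ <-]|_ [F1 ->] _].
    rewrite muln1 => /eqP; rewrite eqb0 -leqNgt -subn_eq0 => /eqP ->.
    by split.
  by split=> // q [].
- move=> k [g' m'] [fr /= hP]; have [/= gN gM gK gB gR] := const_regs_frame fr isT cr.
  have /= st' := static_frame fr isT st; have /= gE := fr_reg fr.
  have mk' (v : 'I_n) : m' (cell fMark v) = ok v by rewrite -mk; apply: (fr_arr fr).
  case: eqP => [F0 [kE sE]|_ _]; last by rewrite muln0.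
  rewrite muln1 eqb0 negbK gM => lt; split; first by rewrite kE subn_gt0.
  have yn := ltn_ord (dst (g' rP)).
  apply: wp_hoare => //=; rewrite /update /= !gB !(gE rU) //= gU !(st_src st') //.
  rewrite !(st_dst st') // !mk' val_eqE.
  have b1 := leq_b1 (src (g' rP) == u).
  have sS : scan P (m2 - g' rP) (g' rP) =
      if P (g' rP) then Some (g' rP).+1 else scan P (m2 - (g' rP).+1) (g' rP).+1.
    by rewrite subnS -[m2 - g' rP in LHS]prednK // subn_gt0.
  bounds b1 lt.
    move=> su; bounds lt yn.
      move=> okd; bounds lt; split=> /=; first by frames.
        by rewrite addn1.
      rewrite -sE sS /P addn1; split=> //.
      by move: su okd; case: (_ == u); case: (ok _).
    move=> okd; bounds lt; split=> /=; first by frames.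
      by rewrite addn1.
    rewrite F0 eqxx -sE sS /P addn1 subnS -kE; split=> //.
    by move: okd; case: (ok _) => //; rewrite andbF.
  move=> su; bounds lt; split=> /=; first by frames.
    by rewrite addn1.
  rewrite F0 eqxx -sE sS /P addn1 subnS -kE; split=> //.
  by move: su; case: (_ == u).
- by split; [frames | rewrite /s1 /update /= gP | rewrite /s1 /update /= gP].
- by rewrite /=; lia.
Qed.

(** * The stack in memory and the simulation of the machine *)

Fixpoint stack_mem (m : nat -> nat) (fs : seq (frame 'I_n)) : Prop :=
  if fs is (u, s, p) :: fs' then
    [/\ m (cell fVert (size fs)) = u, m (cell fStart (size fs)) = s,
        m (cell fPtr (size fs)) = p & stack_mem m fs']
  else m (cell fVert 0) = r.

Lemma stack_mem_eq m m' fs :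
  (forall f i, f \in [:: fVert; fStart; fPtr] -> i <= size fs ->
     m' (cell f i) = m (cell f i)) -> stack_mem m fs -> stack_mem m' fs.
Proof.
elim: fs => [|[[u s] p] fs IH] /= h; first by rewrite h.
move=> [h1 h2 h3 h4]; split; rewrite ?h //; apply: IH => // f i hf hi.
by apply: h => //; apply: leqW.
Qed.

Lemma static_mupdate m f i v : static m -> 3 < f < 10 ->
  static (mupdate m (cell f i) v).
Proof.
move=> st /andP[f3 f10].
apply: (@static_frame [:: f] [::] (State (fun=> 0) m) (State (fun=> 0) _)) st.
  by apply: frame_write => //; rewrite inE.
by rewrite /= f3.
Qed.

(** The stack occupies the arrays numbered 7 to 9, up to index [size fs]. *)
Lemma stack_mem_mupdate m f i v fs : stack_mem m fs -> f < 10 ->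
  (f < 7) || (size fs < i) -> stack_mem (mupdate m (cell f i) v) fs.
Proof.
move=> stk f10 hf; apply: stack_mem_eq stk => f' i' hf' hi'.
have f10' : f' < 10 by move: hf'; rewrite !inE => /or3P[]/eqP->.
rewrite mupdate_cell //; case: eqP => //= ff; case: eqP => //= ii.
case/orP: hf; last by rewrite -ii ltnNge hi'.
by rewrite -ff; move: hf'; rewrite !inE => /or3P[]/eqP->.
Qed.

Section Main.
Variables (G : graph 'I_n) (W : {set 'I_n}).
Hypotheses (r_in : r \in W) (Gconn : connected G).
Hypotheses (arcsP : forall x y, ((x, y) \in arcs) = adj G x y).
Hypotheses (arcs_uniq : uniq arcs) (wsP : ws =i W).

Local Notation step := (mstep G r arcs ws).
Local Notation inv := (minv G W r arcs).

Record rep (c : config 'I_n) s : Prop := Rep {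
  rp_const : const_regs (regs s);
  rp_static : static (mem s);
  rp_d : regs s rD = size c.2;
  rp_mode : regs s rMode = c.1;
  rp_stack : stack_mem (mem s) c.2;
  rp_pos : forall v : 'I_n, mem s (cell fPos v) = position r (verts c.2) v
}.

Lemma prog_growP s u sp p fs : inv (false, (u, sp, p) :: fs) ->
  rep (false, (u, sp, p) :: fs) s ->
  hoare B M prog_grow s (500 * (m2 + n).+1) [::] (rep (step (false, (u, sp, p) :: fs))).
Proof.
move stepE: (step _) => c'; move=> mi [cr st /= sD sM [e1 e2 e3 stk] pos].
have [d dE] : {d | d = size fs} by exists (size fs).
have sz : d.+1 < n by have := minv_size mi; rewrite /= card_ord dE.
rewrite -dE in sD e1 e2 e3.
have pm : p <= m2 by case: (mi) => _ /= /andP[].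
have gr : growing G W r arcs u sp fs by case: (mi) => -[].
have un := gr_uniq gr; have spb := gr_start gr.
case: s cr st sD sM e1 e2 e3 stk pos => g m [/= gN gM gK gB gR] /= st gD gMode e1 e2 e3 stk pos.
have uL := ltn_ord u.
apply: (@hoare_seq _ _ _ _ _ 30 (400 * (m2 + n).+1) _ [::] [::]) => //; last by lia.
apply: wp_hoare => //=; rewrite /update /= !gB !gD; bounds sz.
set s1 := State _ _.
have fr1 : frame_of [::] [:: rU; rS; rP] (State g m) s1 by frames.
have c1 : const_regs (regs s1) by apply: const_regs_frame fr1 isT _.
apply: (@hoare_seq _ _ _ _ _ (200 * (m2 + n).+1) (190 * (m2 + n).+1) _ [::] [::]) => //;
  last by lia.
have ruv : r \notin u :: verts fs by case/andP: un.
have sp0 : 0 < sp by case/andP: spb.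
have suv : size (u :: verts fs) <= n by rewrite /= size_map -[size fs]dE ltnW // ltnW.
have posu (v : 'I_n) : m (cell fPos v) = position r (u :: verts fs) v by rewrite pos.
apply: hoare_weak (prog_searchP (vs := u :: verts fs) (s := s1) arcsP ruv sp0 suv
                     c1 st e2 posu) (leqnn _) _.
move=> s2 [fr2 mk2].
have c2 := const_regs_frame fr2 isT c1; have st2 := static_frame fr2 isT st.
apply: (@hoare_seq _ _ _ _ _ (60 * m2.+1) 129 _ [::] [::]) => //; last by lia.
have g2 x : x \notin [:: rNone; rI; rX; rY; rQI; rQN; rP2] -> regs s2 x = regs s1 x.
  by move=> hx; rewrite (fr_reg fr2).
have s2U : regs s2 rU = u by rewrite g2 //= e1.
have s2P : regs s2 rP = p by rewrite g2 //= e3.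
apply: hoare_weak (prog_scanP c2 st2 s2U s2P pm mk2) (leqnn _) _ => s3.
set res := scan _ _ _ => -[fr3 rF3 rP3].
have [gN3 gM3 gK3 gB3 gR3] := const_regs_frame fr3 isT c2.
have st3 := static_frame fr3 isT st2.
have g3 x : x \notin [:: rNone; rF; rP; rI; rX; rY; rQI; rQN; rP2] ->
    regs s3 x = regs s1 x.
  move=> hx; rewrite (fr_reg fr3) ?(fr_reg fr2) //; apply: contra hx.
    by rewrite !inE => /orP[->|/orP[->|/orP[->|/orP[->|/orP[->|/orP[->|->]]]]]]; rewrite ?orbT.
  by rewrite !inE => /orP[->|/orP[->|->]]; rewrite ?orbT.
have m3 f i : f < 10 -> f \notin [:: fMark; fQueue] -> mem s3 (cell f i) = m (cell f i).
  by move=> f10 hf; rewrite (fr_arr fr3) // (fr_arr fr2).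
have D3 : regs s3 rD = d.+1 by rewrite g3.
have S3 : regs s3 rS = sp by rewrite g3 //= e2.
have U3 : regs s3 rU = u by rewrite g3 //= e1.
have Mo3 : regs s3 rMode = 0 by rewrite g3.
have pos3 (v : 'I_n) : mem s3 (cell fPos v) = position r (u :: verts fs) v.
  by rewrite m3 // posu.
have stk3 : stack_mem (mem s3) fs.
  apply: stack_mem_eq stk => f i hf _; apply: m3; move: hf; rewrite !inE;
  by case/or3P=> /eqP->.
have resE : res = scan (okarc G r arcs u sp fs) (size arcs - p) p by [].
case: s3 fr3 rF3 rP3 gN3 gM3 gK3 gB3 gR3 st3 g3 m3 D3 S3 U3 Mo3 pos3 stk3.
move=> g' m' /= fr3 rF3 rP3 gN3 gM3 gK3 gB3 gR3 st3 g3 m3 D3 S3 U3 Mo3 pos3 stk3.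
have c'E : c' = if res is Some q then
    let v := (nth (r, r) arcs q.-1).2 in
    if position r (u :: verts fs) v == 0 then (false, (v, sp, 0) :: (u, sp, q) :: fs)
    else (true, (u, sp, q) :: fs) else (false, fs) by rewrite -stepE.
have e1' : m' (cell fVert d.+1) = u by rewrite m3.
have e2' : m' (cell fStart d.+1) = sp by rewrite m3.
move: rF3 rP3 c'E; case E: res => [q|] /= F3.
  move/(_ _ erefl) => P3; rewrite -/(position r (u :: verts fs) _) => c'E.
  have [_ hq au av] := minv_scan r_in arcs_uniq mi (etrans (esym resE) E).
  have q1 : q - 1 = q.-1 by rewrite subn1.
  have qm' : q <= m2 by case/andP: hq.
  have qm : q.-1 < m2 by rewrite prednK //; case/andP: hq => /(leq_ltn_trans (leq0n p)).
  set v := (nth (r, r) arcs q.-1).2; have vL := ltn_ord v.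
  have st4 : static (mupdate m' (cell fPtr d.+1) q) by apply: static_mupdate.
  have stk4 : stack_mem (mupdate m' (cell fPtr d.+1) q) ((u, sp, q) :: fs).
    rewrite /= -dE; split; rewrite ?mupdate_cell //= ?eqxx //.
    by apply: stack_mem_mupdate; rewrite ?dE //= ltnSn.
  apply: wp_hoare => //=; rewrite /update /= !gB3 !D3 !P3 !S3 q1 F3.
  rewrite (st_dst st4) // -/v.
  have pv4 : mupdate m' (cell fPtr d.+1) q (cell fPos v) = position r (u :: verts fs) v.
    by rewrite mupdate_cell //= pos3.
  rewrite !pv4; bounds sz qm qm'; last by [].
  move=> _; bounds sz qm qm' vL.
    move=> pv; bounds sz.
    rewrite c'E -/v (negPf pv); split=> //=; first by rewrite D3 dE.
    by move=> x; rewrite mupdate_cell //= pos3.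
  move=> pv; bounds sz vL.
  rewrite c'E -/v pv !addn1; split=> //=.
  - by do 4![apply: static_mupdate => //].
  - by rewrite dE.
  - rewrite -dE; split; rewrite ?mupdate_cell //= ?eqxx //.
    have := stk4; rewrite /= -dE => -[k1 k2 k3 k4].
    split; rewrite ?mupdate_cell //= ?eqxx ?(gtn_eqF (ltnSn _)) ?(ltn_eqF (ltnSn _)) //.
    have up f y m0 : f < 10 -> stack_mem m0 fs ->
        stack_mem (mupdate m0 (cell f d.+2) y) fs.
      by move=> f10 h; apply: stack_mem_mupdate; rewrite // -dE (leqW (leqnn d.+1)) orbT.
    by apply: stack_mem_mupdate => //; do 3![apply: (up) => //].
  - move=> x; rewrite mupdate_cell //= !mupdate_cell //= val_eqE pos3.
    by case: eqP => // _; rewrite size_map -dE.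
move=> _ ->; apply: wp_hoare => //=; rewrite /update /= !gB3 !D3 !U3 F3.
bounds sz uL; first by [].
move=> _; bounds sz uL.
split=> //=.
- exact: static_mupdate.
- by rewrite subn1 /= dE.
- exact: stack_mem_mupdate.
(* The popped vertex is not the root and occurs nowhere else on the stack, so its position is 0
   again. *)
- move=> x; rewrite mupdate_cell //= val_eqE pos3 /=; case: eqP => // ->.
  apply/esym/eqP; rewrite -leqn0 leqNgt position_gt0.
  by case/and3P: un => h1 h2 _; move: h1; rewrite !inE negb_or eq_sym => /andP[/negPf-> _].
Qed.

(** The value [n], which names no vertex, encodes [None]. *)
Lemma prog_terminalP s fs : rep (true, fs) s ->
  hoare B M prog_terminal s (60 * n.+1) [::] (fun s' =>
    frame_of [::] [:: rNone; rW; rI; rX] s s' /\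
    regs s' rW = if next_terminal r ws fs is Some w then val w else n).
Proof.
case: s => g m [cr st /= gD gMo stk pos].
pose pick := foldl (fun o w => if position r (verts fs) w == 0 then Some w else o)
               (None : option 'I_n).
apply: (@hoare_seq _ _ _ _ _ 8 (50 * n + 10) _ [::] [::]) => //; last by lia.
have [/= gN gM gK gB gR] := cr.
apply: wp_hoare => //=; rewrite /update /= gN; bounds.
set s1 := State _ _.
pose I k s' := [/\ frame_of [::] [:: rNone; rW; rI; rX] (State g m) s',
  k + regs s' rI = size ws
  & regs s' rW = if pick (take (regs s' rI) ws) is Some w then val w else n].
apply: (@hoare_while _ _ _ _ I 40 _ (size ws)).
- by move=> k s' _ /=; have b := leq_b1 (regs s' rI < regs s' rK); bounds b.
- move=> k s' [fr hk hw] /=; have [_ _ gK' _ _] := const_regs_frame fr isT cr.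
  rewrite gK' => h; split=> //; rewrite hw take_oversize //; lia.
- move=> k [g' m'] [fr /= hk hw]; have [/= gN' gM' gK' gB' gR'] := const_regs_frame fr isT cr.
  have /= st' := static_frame fr isT st.
  rewrite gK' eqb0 negbK => lt; split; first by lia.
  have pos' (v : 'I_n) : m' (cell fPos v) = position r (verts fs) v.
    by rewrite -pos; apply: (fr_arr fr).
  pose x := nth r ws (g' rI); have xn := ltn_ord x.
  apply: wp_hoare => //=; rewrite /update /= !gB' !gM' !(st_ws st') // -/x !pos'.
  have tk : pick (take (g' rI).+1 ws) =
      if position r (verts fs) x == 0 then Some x else pick (take (g' rI) ws).
    by rewrite (take_nth r lt) /pick foldl_rcons.
  have le1 : 3 + m2 + g' rI < base by rewrite /base; clear -lt; lia.
  bounds lt le1 xn.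
  + move=> px; bounds lt le1; split=> //=.
    * by frames.
    * by rewrite addn1; lia.
    * by rewrite addn1 tk (negPf px).
  + move=> px; bounds lt le1; split=> //=.
    * by frames.
    * by rewrite addn1; lia.
    * by rewrite addn1 tk px.
- by split=> //=; [frames | rewrite addn0 | rewrite take0].
- by rewrite /=; move: ws_le; clear; lia.
Qed.

(** The program emits from the bottom of the stack upwards, whereas the head of [fs] is the top;
    hence the reversals. *)
Definition output_words (fs : seq (frame 'I_n)) : seq nat :=
  (size fs).+1 :: map val (r :: rev (verts fs)) ++
  edge_words (rev (map (chosen r arcs) fs)).

Lemma stack_mem_verts m fs : stack_mem m fs ->
  [seq m (cell fVert i) | i <- iota 0 (size fs).+1] = map val (r :: rev (verts fs)).
Proof.
elim: fs => [|[[u s] p] fs IH]; first by rewrite /= => ->.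
case=> h1 _ _ /IH e; rewrite [verts _]/= rev_cons -rcons_cons map_rcons -e.
by rewrite [size _]/= -[(size fs).+2]addn1 iotaD map_cat cats1 add0n h1.
Qed.

Lemma stack_mem_edges m fs : static m -> stack_mem m fs ->
  all (fun f => 0 < f.2 <= size arcs) fs ->
  flatten [seq [:: m (cell fVert i); m (cell fDst (m (cell fPtr i) - 1))]
          | i <- iota 1 (size fs)] = edge_words (rev (map (chosen r arcs) fs)).
Proof.
move=> st; elim: fs => [|[[u s] p] fs IH] // [h1 _ h3 h4] /andP[hp /(IH h4) e].
rewrite [map (chosen r arcs) _]/= rev_cons -cats1 /edge_words map_cat flatten_cat
  -/(edge_words _) -e.
have -> : size ((u, s, p) :: fs) = size fs + 1 by rewrite addn1.
rewrite iotaD map_cat flatten_cat; congr (_ ++ _).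
rewrite [LHS]/= add1n h1 h3 subn1 (st_dst st) //.
by case: (p) hp.
Qed.

Lemma stack_mem_ptr m fs i : stack_mem m fs ->
  all (fun f => 0 < f.2 <= size arcs) fs -> 0 < i <= size fs ->
  exists2 j, m (cell fPtr i) = j.+1 & j < m2.
Proof.
elim: fs => [|[[u s] p] fs IH]; first by move=> _ _; rewrite leqn0; case: i.
move=> [_ _ h3 h4] /andP[hp /(IH h4) {}IH] /andP[i0].
rewrite leq_eqVlt => /orP[/eqP->|lt]; last by apply: IH; rewrite i0.
by rewrite h3; case: (p) hp => //= p' lt; exists p'.
Qed.

Lemma prog_emitP s fs : rep (true, fs) s -> arrived G W r arcs fs -> size fs < n ->
  hoare B M prog_emit s (100 * n.+1) (output_words fs) (frame_of [::] [:: rI] s).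
Proof.
case: s => g m [cr st /= gD gMo stk pos] ar sz.
have [d dE] : {d | d = size fs} by exists (size fs).
rewrite -dE in gD sz; have [/= gN gM gK gB gR] := cr.
rewrite /output_words -(stack_mem_verts stk) -(stack_mem_edges st stk (ar_ptr ar)) -dE.
set w1 := map _ _; set w2 := flatten _.
have ptr i : 0 < i <= d -> exists2 j, m (cell fPtr i) = j.+1 & j < m2.
  by rewrite dE; apply: stack_mem_ptr (ar_ptr ar).
apply: (@hoare_seq _ _ _ _ _ 5 (90 * n + 80) _ [:: d.+1] (w1 ++ w2)) => //; last by lia.
apply: hoare_emit; [by rewrite /= gD; bounds sz | by rewrite /= gD addn1 | by [] |].
apply: (@hoare_seq _ _ _ _ _ 2 (90 * n + 70) _ [::] (w1 ++ w2)) => //; last by lia.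
apply: wp_hoare => //=; split; first by clear -hB; lia.
set s1 := State _ _.
apply: (@hoare_seq _ _ _ _ _ (30 * n + 40) (50 * n + 25) _ w1 w2) => //; last by clear; lia.
pose I k w s' := [/\ frame_of [::] [:: rI] (State g m) s', k + regs s' rI = d.+1
  & w = [seq m (cell fVert i) | i <- iota (regs s' rI) k]].
apply: (@hoare_while_emit _ _ _ _ I 20 _ d.+1).
- move=> k w s' [fr hk _] /=; rewrite (fr_reg fr (x := rD)) //= gD.
  have b := leq_b1 (regs s' rI < d + 1); bounds b sz.
- move=> k w s' [fr hk hw] /=; rewrite (fr_reg fr (x := rD)) //= gD => h.
  have k0 : k = 0 by clear -h hk; lia.
  split; first by rewrite hw k0.
  move: s' fr {hk hw h I} => [g' m'] fr.
  have /= g'E := fr_reg fr; have /= m'E := fr_arr fr.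
  apply: (@hoare_seq _ _ _ _ _ 2 (50 * n + 20) _ [::] w2) => //; last by clear; lia.
  apply: wp_hoare => //=; split; first by clear -hB; lia.
  set s2 := State _ _.
  pose I k w s' := [/\ frame_of [::] [:: rI] (State g m) s', 0 < regs s' rI,
    k + regs s' rI = d.+1
    & w = flatten [seq [:: m (cell fVert i); m (cell fDst (m (cell fPtr i) - 1))]
                  | i <- iota (regs s' rI) k]].
  apply: (@hoare_while_emit _ _ _ _ I 40 _ d).
  + move=> k1 w' s' [fr' _ hk _] /=; rewrite (fr_reg fr' (x := rD)) //= gD.
    have b := leq_b1 (regs s' rI < d + 1); bounds b sz.
  + move=> k1 w' s' [fr' _ hk hw] /=; rewrite (fr_reg fr' (x := rD)) //= gD => h.
    have k10 : k1 = 0 by clear -h hk; lia.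
    by rewrite hw k10.
  + move=> k1 w' [g1 m1] [fr' /= i0 hk hw]; have /= g1D := fr_reg fr' (x := rD) isT.
    rewrite g1D gD => h.
    have lt : g1 rI < d.+1 by clear -h; lia.
    have k1E : k1 = k1.-1.+1 by clear -lt hk; lia.
    split; first by rewrite k1E.
    have /= g1B := fr_reg fr' (x := rBase) isT; rewrite gB in g1B.
    have m1E f i : f < 10 -> m1 (cell f i) = m (cell f i).
      by move=> f10; apply: (fr_arr fr').
    have [|j pj jm] := ptr (g1 rI); first by rewrite i0.
    exists [:: m1 (cell fVert (g1 rI)); m1 (cell fDst (m1 (cell fPtr (g1 rI)) - 1))].
    exists (flatten [seq [:: m (cell fVert i); m (cell fDst (m (cell fPtr i) - 1))]
                  | i <- iota (g1 rI).+1 k1.-1]).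
    split; first by rewrite hw k1E /= !m1E.
    apply: (@hoare_seq _ _ _ _ _ 10 28 _ [:: m1 (cell fVert (g1 rI))]
              [:: m1 (cell fDst (m1 (cell fPtr (g1 rI)) - 1))]) => //.
    apply: hoare_emit; [by rewrite /= g1B; bounds lt sz | by rewrite /= g1B | by [] |].
    apply: (@hoare_seq _ _ _ _ _ 20 5 _
              [:: m1 (cell fDst (m1 (cell fPtr (g1 rI)) - 1))] [::]) => //.
    apply: hoare_emit; [| by rewrite /= g1B | by [] |].
      by rewrite /= g1B m1E // pj subn1 /=; bounds lt sz jm.
    apply: wp_hoare => //=; rewrite addn1; bounds lt sz.
    split=> //=; first by frames.
    by rewrite /update /=; clear -hk k1E; lia.
  + split=> //=; first by frames.
    by rewrite addn1.
  + by rewrite /=; clear -sz; lia.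
- move=> k w [g1 m1] [fr /= hk hw]; have /= g1D := fr_reg fr (x := rD) isT.
  rewrite g1D gD => h.
  have lt : g1 rI < d.+1 by clear -h; lia.
  have k1E : k = k.-1.+1 by clear -lt hk; lia.
  split; first by rewrite k1E.
  have /= g1B := fr_reg fr (x := rBase) isT; rewrite gB in g1B.
  have m1E f i : f < 10 -> m1 (cell f i) = m (cell f i).
    by move=> f10; apply: (fr_arr fr).
  exists [:: m1 (cell fVert (g1 rI))], [seq m (cell fVert i) | i <- iota (g1 rI).+1 k.-1].
  split; first by rewrite hw k1E /= m1E.
  apply: (@hoare_seq _ _ _ _ _ 10 5 _ [:: m1 (cell fVert (g1 rI))] [::]) => //.
  apply: hoare_emit; [by rewrite /= g1B; bounds lt sz | by rewrite /= g1B | by [] |].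
  apply: wp_hoare => //=; rewrite addn1; bounds lt sz.
  split=> //=; first by frames.
  by rewrite /update /=; clear -hk k1E; lia.
- split=> //=; first by frames.
  by rewrite addn0.
- by rewrite /=; clear -sz; lia.
Qed.

(** Registers 1 to 7 are those that [rep] constrains. *)
Lemma rep_frame R c s s' : all (fun x => ~~ (0 < x < 8)) R ->
  frame_of [::] R s s' -> rep c s -> rep c s'.
Proof.
move=> aR fr [h1 h2 h3 h4 h5 h6].
have out x : 0 < x < 8 -> x \notin R.
  by move=> hx; apply/negP => /(allP aR) /=; rewrite hx.
split.
- apply: const_regs_frame fr _ h1; apply: sub_all aR => x; apply: contra.
  by case/andP=> -> /= h; apply: leq_trans h _.
- exact: static_frame fr isT h2.
- by rewrite (fr_reg fr) ?out.
- by rewrite (fr_reg fr) ?out.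
- apply: stack_mem_eq h5 => f i hf _; apply: (fr_arr fr) => //.
  by move: hf; rewrite !inE => /or3P[]/eqP->.
- by move=> v; rewrite (fr_arr fr).
Qed.

(** * The main loop and its delay *)

Local Notation body := (If $rMode prog_arrive prog_grow).
(** Bounds one turn of the main loop, including the evaluation of its test. *)
Let K := 600 * (m2 + n).+1.

Lemma body_silent c s : inv c -> rep c s -> c <> (false, [::]) -> mout r ws c = [::] ->
  hoare B M body s (K - 5) [::] (rep (step c)).
Proof.
move=> mi rp cne o0; have gMo := rp_mode rp.
apply: (@hoare_if _ _ _ _ _ _ (K - 10)) => //=; last by rewrite /K; clear; lia.
  rewrite gMo; case: c mi rp cne gMo o0 => -[] // fs mi rp _ gMo; rewrite /mout /=.
  case E: next_terminal => [w|] //= _ _.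
  have [wW pw] := next_terminal_some wsP E.
  have sz := minv_size mi; rewrite /= card_ord in sz.
  apply: (@hoare_seq _ _ _ _ _ (60 * n.+1) 130 _ [::] [::]) => //;
    last by rewrite /K; clear; lia.
  apply: hoare_weak (prog_terminalP rp) (leqnn _) _ => s1 [fr1]; rewrite E => W1.
  have rp1 := rep_frame (R := [:: rNone; rW; rI; rX]) isT fr1 rp.
  case: s1 rp1 W1 {fr1 s rp gMo} => g m [/= cr st gD gMo stk pos] gW.
  have [/= gN gM gK gB gR] := cr; have wL := ltn_ord w.
  have [d dE] : {d | d = size fs} by exists (size fs).
  rewrite -dE in gD sz.
  apply: wp_hoare => //=; rewrite /update /= !gB !gD !gN gW.
  have b := leq_b1 (w < n); bounds b; last by rewrite wL.
  move=> _; bounds sz wL.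
  rewrite !addn1; split=> //=.
  - by do 4![apply: static_mupdate => //].
  - by rewrite dE.
  - rewrite -dE; split; rewrite ?mupdate_cell //= ?eqxx //.
    have up f y m0 : f < 10 -> stack_mem m0 fs ->
        stack_mem (mupdate m0 (cell f d.+1) y) fs.
      by move=> f10 h; apply: stack_mem_mupdate; rewrite // -dE ltnSn orbT.
    by apply: stack_mem_mupdate => //; do 3![apply: (up) => //].
  - move=> x; rewrite mupdate_cell //= !mupdate_cell //= val_eqE pos.
    by case: eqP => // _; rewrite size_map -dE.
rewrite gMo; case: c mi rp cne gMo o0 => -[] // [|[[u sp] p] fs] // mi rp _ gMo _ _.
apply: hoare_weak (prog_growP mi rp) _ _ => //; rewrite /K; clear; lia.
Qed.

(** The execution is assembled by hand because [hoare] admits no [Output]. The trace is split there,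
    as [t2] already counts towards the next segment. *)
Lemma body_output fs s : inv (true, fs) -> rep (true, fs) s ->
  next_terminal r ws fs = None ->
  exists t1 t2 s', [/\ exec B M body s (t1 ++ Output :: t2) s',
    [/\ quiet t1, words t1 = output_words fs & size t1 <= K - 50],
    [/\ quiet t2, words t2 = [::] & size t2 <= 5] & rep (step (true, fs)) s'].
Proof.
move=> mi rp E; have sz := minv_size mi; rewrite /= card_ord in sz.
have ar : arrived G W r arcs fs by case: mi => _ _; apply.
have [t1 [s1 [x1 z1 q1 w1 [fr1 W1]]]] := prog_terminalP rp; rewrite E in W1.
have rp1 := rep_frame (R := [:: rNone; rW; rI; rX]) isT fr1 rp.
have [t2 [s2 [x2 z2 q2 w2 fr2]]] := prog_emitP rp1 ar sz.
have rp2 := rep_frame (R := [:: rI]) isT fr2 rp1.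
have B0 : 0 < B by clear -hB; lia.
have x3 : exec B M (rMode <~ #0) s2 [:: Tick; Tick] (State (update (regs s2) rMode 0) (mem s2)).
  by apply: (@ExecAssign _ _ rMode #0 s2 0); rewrite /= /below B0.
have sN : regs s1 rN = n by case: (rp_const rp1).
have x4 := ExecSeq x2 (ExecSeq (ExecYield B M s2) x3).
have e5 : eval B M s1 ($rW [<] $rN) = Some 0 by rewrite /= W1 sN ltnn /below B0.
have x6 := ExecSeq x1 (@ExecIf B M ($rW [<] $rN) (prog_push $rW $rD ;; rMode <~ #0)
                         _ s1 0 _ _ e5 x4).
have e7 : eval B M s $rMode = Some 1 by rewrite /= (rp_mode rp).
have x7 := @ExecIf B M $rMode _ prog_grow s 1 _ _ e7 x6.
pose u1 := rcons (ticks $rMode) Tick ++ Tick :: t1 ++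
  rcons (ticks ($rW [<] $rN)) Tick ++ Tick :: t2 ++ [:: Tick].
exists u1, [:: Tick; Tick], (State (update (regs s2) rMode 0) (mem s2)); split.
- by move: x7; rewrite /u1 /= -!catA /= -!catA.
- split.
  + by rewrite /u1 -[Tick :: t1 ++ _]cat1s -[Tick :: t2 ++ _]cat1s !quiet_cat q1 q2.
  + rewrite /u1 -[Tick :: t1 ++ _]cat1s -[Tick :: t2 ++ _]cat1s !words_cat w1 w2 /=.
    by rewrite cats0.
  + rewrite /u1 -[Tick :: t1 ++ _]cat1s -[Tick :: t2 ++ _]cat1s !size_cat /=.
    by rewrite /K; clear -z1 z2; lia.
- by [].
- rewrite /= E; case: rp2 => h1 h2 h3 h4 h5 h6; split=> //.
Qed.

Lemma mouts_halted N : mouts G r arcs ws N (false, [::]) = [::].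
Proof. by elim: N => //= N IH; rewrite /mouts /= -/(mouts _ _ _ _ N _) IH. Qed.

(** Only the first segment depends on the current configuration, through its potential; the later
    ones get the uniform bound of [potential_le]. *)
Lemma prog_loopP N c s : inv c -> rep c s -> iter N step c = (false, [::]) ->
  exists t s', exec B M prog_loop s t s' /\
    traced t (map output_words (mouts G r arcs ws N c))
      ((potential c).+1 * K) ((3 * n + 4) * K).
Proof.
elim: N c s => [|N IH] c s mi rp.
  move=> /= cE; subst c; exists [:: Tick; Tick; Tick; Tick], s; split.
    apply: ExecWhileFalse; rewrite /= (rp_d rp) (rp_mode rp) /= /below.
    by case: ifP => //; clear -hB; lia.
  by apply: traced_nil => //=; rewrite /K; clear; lia.
(* [N] may exceed the number of turns of the loop: steps from the halting configuration output
   nothing and are dropped. *)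
rewrite iterSr => itE; case: (eqVneq c (false, [::])) => [cE|/eqP cne].
  subst c; have [t [s' h]] := IH _ _ mi rp itE; exists t, s'; move: h.
  by rewrite !mouts_halted.
have mi' := minv_step r_in Gconn arcsP arcs_uniq wsP mi.
have condE : eval B M s ($rD [+] $rMode) = Some (size c.2 + c.1).
  rewrite /= (rp_d rp) (rp_mode rp) /= /below; have := minv_size mi.
  rewrite card_ord; have := leq_b1 c.1; case: ifP => // /negP; clear -hB; lia.
have cond0 : size c.2 + c.1 != 0 by case: (c) cne => -[] [].
have -> : mouts G r arcs ws N.+1 c = mout r ws c ++ mouts G r arcs ws N (step c) by [].
case: (eqVneq (mout r ws c) [::]) => [o0|o1].
  have [t1 [s1 [x1 z1 q1 w1 rp1]]] := body_silent mi rp cne o0.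
  have [t [s' [x tr]]] := IH _ _ mi' rp1 itE.
  exists (rcons (ticks ($rD [+] $rMode)) Tick ++ t1 ++ t), s'; split.
    exact: ExecWhileTrue condE cond0 x1 x.
  rewrite o0 catA; apply: traced_quiet tr _; rewrite ?words_cat ?w1 //.
  have := potential_step r_in Gconn arcsP arcs_uniq wsP mi cne o0.
  move: (potential _) (potential c) => a b ab; rewrite size_cat /=.
  apply: (@leq_trans (a.+2 * K)); last by rewrite leq_mul2r ltnS ab orbT.
  by rewrite [X in _ <= X]mulSn leq_add2r; move: z1; rewrite /K; clear; lia.
have [c1 E] : c.1 /\ next_terminal r ws c.2 = None.
  by move: o1; rewrite /mout; case: (c.1) => //=; case: next_terminal.
case: c c1 E mi rp itE cne mi' condE cond0 o1 => -[] // fs _ E mi rp itE cne mi' condE cond0 o1.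
rewrite [_.2]/= in E; have [t1 [t2 [s1 [x1 [q1 w1 z1] [q2 w2 z2] rp1]]]] := body_output mi rp E.
have [t [s' [x tr]]] := IH _ _ mi' rp1 itE.
exists (rcons (ticks ($rD [+] $rMode)) Tick ++ (t1 ++ Output :: t2) ++ t), s'; split.
  exact: ExecWhileTrue condE cond0 x1 x.
pose t0 := rcons (ticks ($rD [+] $rMode)) Tick ++ t1.
have -> : rcons (ticks ($rD [+] $rMode)) Tick ++ (t1 ++ Output :: t2) ++ t =
          t0 ++ Output :: (t2 ++ t) by rewrite /t0 -!catA.
have -> : map output_words (mout r ws (true, fs) ++ mouts G r arcs ws N (step (true, fs)))
        = words t0 :: map output_words (mouts G r arcs ws N (step (true, fs))).
  by rewrite /mout [_ && _]/= E /t0 words_cat w1.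
have pot := potential_le r_in arcs_uniq mi'; rewrite card_ord in pot.
apply: (@traced_output _ _ _ ((3 * n + 4) * K)) => //.
- apply: traced_quiet tr _ => //.
  (* At most 5 units are spent in the body after [Output], and the rest of the segment is bounded by
     the potential plus one, at most [3 * n + 3] turns. One more [K] absorbs the 5. *)
  apply: (@leq_trans (5 + (3 * n + 3) * K)).
    by apply: leq_add => //; rewrite leq_mul2r; apply/orP; right;
       apply: leq_ltn_trans pot _; rewrite ltn_add2l.
  have -> : 3 * n + 4 = (3 * n + 3).+1 by rewrite -addnS.
  by rewrite [X in _ <= X]mulSn leq_add2r /K; clear; lia.
- rewrite /t0 size_cat /= mulSn ltn_addr //; move: z1; rewrite /K; clear; lia.
Qed.

(** * Construction of the adjacency lists and the whole run *)

Section Build.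
Variable m0 : nat -> nat.
Hypotheses (m0_src : forall i, i < m2 -> m0 (3 + i) = src i).
Hypotheses (m0_dst : forall i, i < m2 -> m0 (3 + (4 * (i %/ 2) + 1 - i)) = dst i).
Hypotheses (m0_ws : forall i, i < size ws -> m0 (3 + m2 + i) = nth r ws i).
Hypotheses (m0_zero : forall i, base <= i -> m0 i = 0).

(** Each arc is inserted at the head of the list of its source. After [i] insertions the head for
    [v] is therefore [last_arc v i], and arc [i] gets the previous head as its successor. *)
Lemma prog_buildP g : g rM = m2 -> g rBase = base -> ~~ odd m2 ->
  hoare B M prog_build (State g m0) (100 * m2.+1) [::] (fun s' =>
    frame_of [:: fHead; fNext; fSrc; fDst] [:: rI; rX; rY] (State g m0) s' /\
    static (mem s')).
Proof.
move=> gM gB ev_m2.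
apply: (@hoare_seq _ _ _ _ _ 2 (90 * m2 + 10) _ [::] [::]) => //; last by clear; lia.
apply: wp_hoare => //=; split; first by clear -hB; lia.
set s1 := State _ _.
pose I k s' := [/\ frame_of [:: fHead; fNext; fSrc; fDst] [:: rI; rX; rY] (State g m0) s',
  k + regs s' rI = m2,
  forall i, i < regs s' rI -> [/\ mem s' (cell fSrc i) = src i,
    mem s' (cell fDst i) = dst i & mem s' (cell fNext i) = last_arc (src i) i]
  & forall v : 'I_n, mem s' (cell fHead v) = last_arc v (regs s' rI)].
apply: (@hoare_while _ _ _ _ I 80 _ m2).
- by move=> k s' _ /=; have b := leq_b1 (regs s' rI < regs s' rM); bounds b.
- move=> k s' [fr hk hi hv] /=; rewrite (fr_reg fr (x := rM)) //= gM => h.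
  have e : regs s' rI = m2 by clear -h hk; lia.
  rewrite e in hi hv; split=> //; split=> // [i /hi[]|i /hi[]|i /hi[]|i im] //.
  by rewrite (fr_inp fr) /= ?m0_ws // /base; clear -im; lia.
- move=> k [g' m'] [fr /= hk hi hv]; have /= gE := fr_reg fr.
  rewrite (gE rM) // gM eqb0 negbK => lt; split; first by clear -lt hk; lia.
  pose x := src (g' rI); pose y := dst (g' rI).
  have le1 : 3 + g' rI < base by rewrite /base; clear -lt; lia.
  (* As [m2] is even, the partner of the last edge word is again an edge word. *)
  have le2 : 3 + (4 * (g' rI %/ 2) + 1 - g' rI) < base.
    by rewrite /base; clear -lt ev_m2; lia.
  have ex : m' (3 + g' rI) = x by rewrite -m0_src //; apply: (fr_inp fr).
  have ey : m' (3 + (4 * (g' rI %/ 2) + 1 - g' rI)) = y.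
    by rewrite -m0_dst //; apply: (fr_inp fr).
  have [xn yn] := (ltn_ord x, ltn_ord y).
  have q2 : g' rI %/ 2 <= m2 by clear -lt; lia.
  apply: wp_hoare => //=; rewrite /update /= !(gE rBase) //= gB !ex !ey.
  bounds lt le1 le2 xn yn q2.
  rewrite addn1; split=> /=.
  + by frames.
  + by clear -hk lt; lia.
  + move=> i; rewrite ltnS leq_eqVlt => /orP[/eqP->|lti].
      by rewrite !mupdate_cell //= !eqxx hv.
    have [h1 h2 h3] := hi i lti; have ne : (i == g' rI) = false by apply: ltn_eqF.
    by rewrite !mupdate_cell //= ne.
  + move=> v; rewrite !mupdate_cell //= val_eqE (eq_sym v) -/x.
    by case: eqP.
- split=> //=; first by frames.
    by rewrite addn0.
  by move=> v; rewrite m0_zero // leq_addr.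
- by rewrite /=; clear; lia.
Qed.

Hypotheses (m0_n : m0 0 = n) (m0_m : 2 * m0 1 = m2) (m0_k : m0 2 = size ws).
Hypotheses (ws_gt0 : 0 < size ws) (ws_root : nth r ws 0 = r).

Lemma prog_runP N : iter N step (true, [::]) = (false, [::]) ->
  exists t s', exec B M prog (State (fun=> 0) m0) t s' /\
    traced t (map output_words (mouts G r arcs ws N (true, [::])))
      ((3 * n + 4) * K) ((3 * n + 4) * K).
Proof.
move=> itE; have rn := ltn_ord r.
have ev_m2 : ~~ odd m2 by rewrite -m0_m mul2n odd_double.
pose g1 := update (update (update (update (fun=> 0) rN n) rM m2) rK (size ws)) rBase base.
have h1 : hoare B M (rN <~ Read #0 ;; rM <~ #2 [*] Read #1 ;; rK <~ Read #2 ;;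
    rBase <~ #3 [+] $rM [+] $rK) (State (fun=> 0) m0) 40 [::] (fun s => s = State g1 m0).
  apply: wp_hoare => //=; rewrite /update /= m0_n m0_m m0_k.
  have mm : m0 1 <= m2 by clear -m0_m; lia.
  by bounds mm; rewrite /g1 /update.
have [t1 [s1 [x1 z1 q1 w1 e1]]] := h1; subst s1.
have [//|//|t2 [[g2 m2'] [x2 z2 q2 w2 [fr2 st2]]]] := @prog_buildP g1 _ _ ev_m2.
rewrite [mem _]/= in st2; have /= g2E := fr_reg fr2; have /= m2E := fr_arr fr2.
have i0 : m2' (3 + m2) = r.
  by rewrite -[3 + m2]addn0 (st_ws st2) // ws_root.
pose c3 := rRoot <~ Read (#3 [+] $rM) ;; put fPos $rRoot #1 ;; put fVert #0 $rRoot ;;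
   rD <~ #0 ;; rMode <~ #1.
have h3 : hoare B M c3 (State g2 m2') 50 [::] (rep (true, [::])).
  apply: wp_hoare => //=; rewrite /update /= (g2E rM) // (g2E rBase) //= /g1 /update /= i0.
  bounds rn; split=> //=.
  - by rewrite /const_regs /= !g2E.
  - by do 2![apply: static_mupdate => //].
  - by rewrite mupdate_cell.
  - move=> v; rewrite mupdate_cell //= mupdate_cell //= val_eqE.
    by case: eqP => //= _; rewrite m2E // m0_zero // leq_addr.
have [t3 [s3 [x3 z3 q3 w3 rp3]]] := h3.
have [t4 [s4 [x4 tr4]]] := prog_loopP (minv_init _ _ _ _) rp3 itE.
have x5 := ExecSeq x2 (ExecSeq x3 x4).
have e5 : eval B M (State g1 m0) $rK = Some (size ws) by [].
have x6 := @ExecIf B M $rK _ (Emit #0 ;; Yield) (State g1 m0) (size ws) _ _ e5.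
rewrite -lt0n ws_gt0 in x6; have x7 := ExecSeq x1 (x6 _ _ _ x5).
exists (([:: Tick] ++ t1 ++ rcons (ticks $rK) Tick ++ [:: Tick] ++ t2 ++ [:: Tick] ++ t3)
        ++ t4), s4.
split; first by move: x7; rewrite /= -!catA /= -!catA.
apply: traced_quiet tr4 _.
- by rewrite !quiet_cat q1 q2 q3.
- by rewrite !words_cat w1 w2 w3.
- rewrite !size_cat /= card_ord subn0.
  (* [2 * n + 1] is the potential of the initial configuration; the summand [n.+1] pays for the
     set-up. *)
  have -> : 3 * n + 4 = n.+1 + (2 * n + 1).+2 by clear; lia.
  rewrite [X in _ <= X]mulnDl -[2 * n + 1]/(2 * n + 1); apply: leq_add.
    by rewrite mulSn; apply: leq_trans (leq_addr _ _); move: z1 z2 z3; rewrite /K; clear; lia.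
  by rewrite leq_mul2r leqnSn orbT.
Qed.

End Build.
End Main.

End Ram.

Local Close Scope ram_scope.

(** * Encodings and resource bounds *)

Section Encoding.
Variable n : nat.
Implicit Types (es : seq ('I_n * 'I_n)) (G : graph 'I_n) (W : {set 'I_n}).

(** The two orientations are adjacent, so that arc [i] starts at edge word [i] and ends at the
    partner of that word. *)
Definition arcs_of es : seq ('I_n * 'I_n) :=
  flatten [seq [:: (e.1, e.2); (e.2, e.1)] | e <- es].

Lemma size_arcs_of es : size (arcs_of es) = 2 * size es.
Proof. by elim: es => //= e es IH; rewrite IH mulnS. Qed.

Lemma arcs_of_words r es i : i < size (arcs_of es) ->
  nth 0 (edge_words es) i = (nth (r, r) (arcs_of es) i).1 /\
  nth 0 (edge_words es) (4 * (i %/ 2) + 1 - i) = (nth (r, r) (arcs_of es) i).2.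
Proof.
elim: es i => //= e es IH [|[|i]] // lt.
have -> : 4 * (i.+2 %/ 2) + 1 - i.+2 = (4 * (i %/ 2) + 1 - i).+2 by lia.
exact: IH.
Qed.

Lemma size_edge_words es : size (edge_words es) = 2 * size es.
Proof. by elim: es => //= e es IH; rewrite IH mulnS. Qed.

Lemma card_edges es G : lists_edges es (edges G) -> #|edges G| = size es.
Proof.
by case=> un mm; rewrite -(eq_card mm) (card_uniqP un) size_map.
Qed.

Lemma edge_neq es G e : lists_edges es (edges G) -> e \in es -> e.1 != e.2.
Proof.
by case=> _ mm ein; apply: (@adj_neq _ G); rewrite /adj -mm;
  apply: (map_f (fun e => [set e.1; e.2])).
Qed.

Lemma set2_eq (T : finType) (x y a b : T) : x != y -> [set x; y] = [set a; b] ->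
  (x = a /\ y = b) \/ (x = b /\ y = a).
Proof.
move=> ne eqs; have := set21 x y; have := set22 x y; rewrite eqs !inE.
by case/orP=> /eqP yE /orP[]/eqP xE;
  [rewrite xE yE eqxx in ne | right | left | rewrite xE yE eqxx in ne].
Qed.

Lemma arcs_of_adj es G : lists_edges es (edges G) ->
  forall x y, ((x, y) \in arcs_of es) = adj G x y.
Proof.
move=> le x y; have [_ mm] := le; apply/flatten_mapP/idP => [[e ein]|xy].
  rewrite !inE => /orP[]/eqP[-> ->]; rewrite /adj -mm; last rewrite setUC;
  exact: (map_f (fun e => [set e.1; e.2])).
have := xy; rewrite {1}/adj -mm => /mapP[e ein].
by case/(set2_eq (adj_neq xy)) => -[-> ->]; exists e; rewrite // !inE eqxx ?orbT.
Qed.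

Lemma arcs_of_uniq es G : lists_edges es (edges G) -> uniq (arcs_of es).
Proof.
move=> le; have [un _] := le; have ne e := @edge_neq es G e le.
elim: es un ne {le} => //= -[a b] es IH /andP[out un] ne.
have nab : a != b by apply: (ne (a, b)); rewrite inE eqxx.
have {}IH : uniq (arcs_of es) by apply: IH => // e ein; apply: ne; rewrite inE ein orbT.
have out' x y : [set x; y] = [set a; b] -> (x, y) \notin arcs_of es.
  move=> eqs; apply: contra out => /flatten_mapP[e ein]; rewrite /= -eqs !inE.
  by case/orP=> /eqP[-> ->]; [|rewrite setUC]; apply: (map_f (fun e => [set e.1; e.2])).
rewrite inE negb_or IH (out' a b) // (out' b a (setUC _ _)) !andbT.
by apply: contra nab => /eqP[-> _].
Qed.

(** In a connected graph with a second vertex every vertex has a neighbour, hence is the source of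
    an arc. *)
Lemma card_le_arcs es G : lists_edges es (edges G) -> connected G -> 1 < n ->
  n <= 2 * size es.
Proof.
move=> le Gc n1; rewrite -size_arcs_of -(size_map fst) -[X in X <= _]card_ord.
apply: leq_trans (card_size _); apply: subset_leq_card; apply/subsetP=> x _.
have [y yx] : exists y, y != x.
  case: (eqVneq x (Ordinal n1)) => [->|ne]; last by exists (Ordinal n1); rewrite eq_sym.
  by exists (Ordinal (ltnW n1)).
rewrite eq_sym in yx; have [z xz _] := connect_step_avoid (Gc x y) yx.
by apply/mapP; exists (x, z); rewrite // (arcs_of_adj le).
Qed.

Lemma encodes_output G W r arcs fs : arrived G W r arcs fs ->
  encodes (output_words r arcs fs) (subgraph_of r arcs fs).
Proof.
move=> ar; exists (r :: rev (verts fs)), (rev (map (chosen r arcs) fs)); split.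
- split; first by have := ar_uniq ar; rewrite /= rev_uniq mem_rev.
  by move=> x; rewrite in_set !in_cons mem_rev.
- split; first by rewrite map_rev rev_uniq (chosen_edges_uniq ar).
  move=> e; rewrite map_rev mem_rev; apply/mapP/imsetP => -[a ain ->]; by exists a.
- by rewrite /output_words /= size_rev size_map.
Qed.

End Encoding.

(** [X] is at least 2 and exceeds [n]: of nine factors [X], seven give 128 and two give the
    square. *)
Lemma word_bound_ge c n : 9 <= c -> 128 * n.+1 ^ 2 <= word_bound c n.
Proof.
move=> c9; rewrite /word_bound [c * _]mulnC expnM; set X := 2 ^ _.
have nX : n < X by apply: trunc_log_ltn.
have X2 : 2 <= X by rewrite -[2]expn1 leq_exp2l.
apply: (@leq_trans (X ^ 9)); last by rewrite leq_exp2l.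
rewrite (expnD X 7 2); apply: leq_mul; last by rewrite leq_sqr.
by rewrite (@leq_exp2r 2 X 7).
Qed.

Lemma minimal_steiner_set0 (T : finType) (G : graph T) (H : vesets T) :
  minimal_steiner_tree G set0 H <-> H = (set0, set0).
Proof.
have st K : is_subgraph G K -> steiner_subgraph G set0 K.
  by move=> Ks; split=> // u v; rewrite inE.
have sub0 : is_subgraph G (set0, set0).
  by split=> /=; [apply: sub0set | move=> e; rewrite inE].
split=> [[[Hs _] Hmin]|->].
  apply/eqP/negPn/negP => /eqP ne; apply: (Hmin (set0, set0)); last exact: st.
  by split=> //=; [apply: sub0set | apply: sub0set | move=> e; apply: ne].
split; first exact: st.
by move=> K [_]; rewrite !subset0 => /eqP K1 /eqP K2 [] ; rewrite [K]surjective_pairing K1 K2.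
Qed.

Lemma steiner_enumeration c n (G : graph 'I_n) (W : {set 'I_n}) es ws :
  600 * 27 <= c -> connected G -> lists_edges es (edges G) -> lists ws W ->
  exists t : seq event,
    [/\ run (word_bound c n) (nm_bound c n #|edges G|) prog (input_words es ws) t,
        enumerates t (minimal_steiner_tree G W)
      & delay t <= nm_bound c n #|edges G|].
Proof.
move=> hc Gc le [wu wm]; rewrite (card_edges le).
have [m mE] : {m | m = size es} by exists (size es).
rewrite -mE.
have m_le : m <= n * n.
  have ue : uniq es by apply: (map_uniq le.1).
  by rewrite mE -(card_uniqP ue) (leq_trans (max_card _)) // card_prod card_ord.
have k_le : size ws <= n by rewrite -(card_uniqP wu) -[X in _ <= X]card_ord max_card.
have m_nm : m <= n * m.
  by case: (posnP n) m_le => [->|n0 _]; [rewrite leqn0 => /eqP-> | rewrite leq_pmull].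
(* From [n <= 2 * m] when [n > 1]; the [+ 1] covers the graph with a single vertex. *)
have nn : n * n <= 2 * (n * m) + 1.
  by case: (leqP n 1) => [|/(card_le_arcs le Gc)]; rewrite -?mE; clear; nia.
have n_nm : n <= n * m + 1.
  by case: (leqP n 1) => [|/(card_le_arcs le Gc)]; rewrite -?mE; clear; nia.
set B := word_bound c n; set M := nm_bound c n m.
have hB : 3 + 2 * m + size ws + 10 * (2 * m + n).+2 <= B.
  apply: leq_trans (word_bound_ge n _); last by move: hc; clear; lia.
  by move: m_le k_le; clear; nia.
have hM : 3 + 2 * m + size ws + 10 * (2 * m + n).+2 <= M.
  apply: (@leq_trans (600 * 27 * (n * m).+1)); last by rewrite leq_mul2r hc orbT.
  by move: m_nm k_le n_nm; clear; lia.
(* Origin of 27: without the factor 600 the product is [6nm + 3n^2 + 7n + 8m + 4], and the bounds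
   above turn it into [6 + 6 + 7 + 8] times [nm] plus a constant 14. *)
have hD : (3 * n + 4) * (600 * (2 * m + n).+1) <= M.
  apply: (@leq_trans (600 * 27 * (n * m).+1)); last by rewrite leq_mul2r hc orbT.
  by move: m_nm nn n_nm; clear; nia.
have sz_in : size (input_words es ws) = 3 + 2 * m + size ws.
  by rewrite /input_words !size_cat size_map size_edge_words -mE addnA.
have in_M : size (input_words es ws) <= M by rewrite sz_in; move: hM; clear; lia.
have in_B : all (fun v => v < B) (input_words es ws).
  have [nB mB] : n < B /\ m < B by split; move: hB; clear; lia.
  rewrite /= !all_cat /= -mE nB mB (leq_ltn_trans k_le nB) /=; apply/andP; split.
    apply/allP=> x /flattenP[l /mapP[e _ ->]]; rewrite !inE.
    by case/orP=> /eqP->; apply: ltn_trans nB; apply: ltn_ord.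
  by apply/allP=> x /mapP[w _ ->]; apply: ltn_trans nB; apply: ltn_ord.
case: ws wm wu k_le hB hM sz_in in_M in_B => [|r ws] wm wu k_le hB hM sz_in in_M in_B.
  (* Without terminals there is no root. The only solution is the empty subgraph, encoded by the
     single word 0; otherwise the first listed terminal serves as root. *)
  have W0 : W = set0 by apply/setP => x; rewrite -wm !inE.
  pose s1 := State (update (update (update (update (fun=> 0) rN n) rM (2 * m)) rK 0)
                      rBase (3 + 2 * m)) (nth 0 (input_words es [::])).
  have h1 : hoare B M (rN <~ Read #0 ;; rM <~ #2 [*] Read #1 ;; rK <~ Read #2 ;;
      rBase <~ #3 [+] $rM [+] $rK)%ram (State (fun=> 0) (nth 0 (input_words es [::])))
      40 [::] (fun s => s = s1).
    apply: wp_hoare => //=; rewrite /update /= -mE addn0.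
    by do ?split; rewrite /s1 /update //; move: hB hM; clear; lia.
  have [t1 [s2 [x1 z1 q1 w1 e1]]] := h1; subst s2.
  have B0 : 0 < B by move: hB; clear; lia.
  have x2 : exec B M (Emit (Const 0)) s1 [:: Tick; Word 0] s1.
    by apply: (@ExecEmit B M (Const 0) s1 0); rewrite /= /below B0.
  have x3 c1 := @ExecIf B M (Reg rK) c1 _ s1 0 _ _ erefl (ExecSeq x2 (ExecYield B M s1)).
  pose t0 := [:: Tick] ++ t1 ++ [:: Tick; Tick; Tick; Tick; Word 0].
  have wt0 : words t0 = [:: 0] by rewrite !words_cat w1.
  have tr : traced (t0 ++ [:: Output]) [:: [:: 0]] 100 0.
    rewrite -wt0; apply: (@traced_output _ [::] [::] 0) => //.
    - by rewrite !quiet_cat q1.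
    - by rewrite !size_cat /=; move: z1; clear; lia.
  exists (t0 ++ [:: Output]); split.
  - by split=> //; exists s1; rewrite /t0 -!catA; apply: (ExecSeq x1 (x3 _)).
  - exists [:: (set0, set0)], [:: [:: 0]]; split=> //; last first.
    + case=> // _; exists [::], [::]; split=> //=; split=> // x; by rewrite !inE.
    + by case: tr.
    + by move=> H; rewrite W0 minimal_steiner_set0 inE; split=> /eqP.
  - apply: traced_delay tr _ _ => //; rewrite /M /nm_bound.
    apply: leq_trans (leq_pmulr _ (ltn0Sn _)); apply: leq_trans hc; by clear; lia.
set ws' := r :: ws; have r_in : r \in W by rewrite -wm mem_head.
pose arcs := arcs_of es; have sa : size arcs = 2 * m by rewrite size_arcs_of mE.
have aP := arcs_of_adj le; have aU := arcs_of_uniq le.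
have [N [itE Hu HP Har]] := explore_all r_in Gc aP aU wm.
have hB' : 3 + size arcs + size ws' + 10 * (size arcs + n).+2 <= B by rewrite sa.
have hM' : 3 + size arcs + size ws' + 10 * (size arcs + n).+2 <= M by rewrite sa.
have in1 i : i < size arcs -> nth 0 (input_words es ws') (3 + i) = nth 0 (edge_words es) i.
  move=> lt; rewrite /input_words nth_cat /= subSS subSS subSS subn0 nth_cat size_edge_words -mE.
  by rewrite -sa lt.
have [] := @prog_runP B M n r arcs ws' hB' hM' k_le G W r_in Gc aP aU wm
  (nth 0 (input_words es ws')) _ _ _ _ _ _ _ isT erefl N itE.
- by move=> i lt; rewrite in1 //; case: (arcs_of_words r lt).
- move=> i lt; rewrite in1; first by case: (arcs_of_words r lt).
  by move: lt; rewrite sa; clear; lia.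
- move=> i lt; rewrite /input_words -addnA nth_cat /= !subSS subn0 nth_cat.
  rewrite size_edge_words -mE -sa ltnNge leq_addr /= addKn.
  exact: (@nth_map _ r _ 0 val _ ws').
- by move=> i le'; rewrite nth_default // sz_in -sa.
- by [].
- by rewrite sa mE.
- by [].
move=> t [s' [x tr]]; exists t; split.
- by split=> //; exists s'.
- exists (map (subgraph_of r arcs) (mouts G r arcs ws' N (true, [::]))).
  exists (map (output_words r arcs) (mouts G r arcs ws' N (true, [::]))).
  split=> //; first by case: tr.
    by rewrite !size_map.
  move=> i; rewrite size_map => lt; rewrite (nth_map [::]) // (nth_map [::]) //.
  by have [/encodes_output] := Har _ (mem_nth [::] lt).
- by apply: traced_delay tr _ _; rewrite sa.
Qed.

Theorem theorem4p3 :
  exists (p : cmd) (c : nat),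
    forall (n : nat) (G : graph 'I_n) (W : {set 'I_n}),
      connected G ->
      forall (es : seq ('I_n * 'I_n)) (ws : seq 'I_n),
        lists_edges es (edges G) -> lists ws W ->
        exists t : seq event,
          [/\ run (word_bound c n) (nm_bound c n #|edges G|) p
                  (input_words es ws) t,
              enumerates t (minimal_steiner_tree G W)
            & delay t <= nm_bound c n #|edges G|].
Proof.
exists prog, (600 * 27) => n G W Gc es ws le lw.
exact: steiner_enumeration (leqnn _) Gc le lw.
Qed.
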